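(* Let $L$ be a countable relational language and let $\mu$ be a properly ergodic structure on $\mathrm{Str}_L$. Then the complete $\mathcal{L}_{\omega_1,\omega}$-theory $\mathrm{Th}(\mu)$ has no models (of any cardinality). However, for any countable fragment $F$ of $\mathcal{L}_{\omega_1,\omega}$, the theory $\mathrm{Th}_F(\mu)$ has continuum-many countable models up to isomorphism.
   Context: $\mathrm{Str}_L$ is the space of $L$-structures with domain $\mathbb{N}$, with the topology generated by the sets $\{M : M\models R(\overline{a})\}$ and $\{M: M\models\lnot R(\overline{a})\}$ ($R\in L$, $\overline a$ a tuple from $\mathbb{N}$). The logic action of $\mathrm{Sym}(\mathbb{N})$ on $\mathrm{Str}_L$ is by permuting the underlying set; its orbits are the isomorphism classes in $\mathrm{Str}_L$. A Borel probability measure $\mu$ on $\mathrm{Str}_L$ is invariant if $\mu(\sigma[X])=\mu(X)$ for all Borel $X$ and $\sigma\in\mathrm{Sym}(\mathbb{N})$. An invariant $\mu$ is ergodic if every Borel $X$ with $\mu(X\triangle\sigma[X])=0$ for all $\sigma\in \mathrm{Sym}(\mathbb{N})$ has $\mu(X)\in\{0,1\}$. An ergodic structure is an ergodic invariant probability measure on $\mathrm{Str}_L$; it is properly ergodic if it assigns measure $0$ to every orbit of the logic action. For a sentence $\varphi$ of $\mathcal{L}_{\omega_1,\omega}$, $\mu\models\varphi$ means $\mu(\{M\in\mathrm{Str}_L: M\models\varphi\})=1$. $\mathrm{Th}(\mu)$ is the set of all sentences $\varphi$ of $\mathcal{L}_{\omega_1,\omega}$ with $\mu\models\varphi$, and $\mathrm{Th}_F(\mu)=\mathrm{Th}(\mu)\cap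 F$. $\mathcal{L}_{\omega_1,\omega}$ extends first-order logic by conjunctions and disjunctions of countable families of formulas with a common finite set of free variables; all variables come from a fixed countable supply. A fragment is a set of $\mathcal{L}_{\omega_1,\omega}$-formulas containing all atomic formulas and closed under subformulas, finite Boolean combinations, quantification, and substitution of free variables. *)

(* Defs.v *)
From HB Require Import structures.
From mathcomp Require Import all_boot all_order all_algebra.
From mathcomp Require Import all_classical all_reals all_analysis.

Set Implicit Arguments.
Unset Strict Implicit.
Unset Printing Implicit Defensive.

Local Open Scope classical_set_scope.

Record language := Language {
  symbol :> Type;
  arity : symbol -> nat
}.

Record structure (L : language) := Structure {
  carrier :> Type;
  carrier_inhabited : inhabited carrier;
  rel_interp : forall r : L, (arity r).-tuple carrier -> Prop
}.

Definition isomorphic (L : language) (M N : structure L) : Prop :=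
  exists f : M -> N, bijective f /\
    forall (r : L) (a : (arity r).-tuple M),
      rel_interp a <-> rel_interp (map_tuple f a).

(** * The infinitary logic *)

(* Index types of the countable families: finite (possibly empty) or nat. *)
Definition family_index (k : option nat) : Type :=
  if k is Some n then 'I_n else nat.

(* The variables are the natural numbers.  [preformula] does not impose that
   the members of a family have a common finite set of free variables; this is
   [is_formula] below. *)
Inductive preformula (L : language) : Type :=
| FEq (x y : nat)
| FRel (r : L) (v : (arity r).-tuple nat)
| FNot (p : preformula L)
| FConj (k : option nat) (f : family_index k -> preformula L)
| FDisj (k : option nat) (f : family_index k -> preformula L)
| FEx (x : nat) (p : preformula L)
| FAll (x : nat) (p : preformula L).

Arguments FEq {L} x y.
Arguments FRel {L} r v.
Arguments FConj {L} k f.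
Arguments FDisj {L} k f.

Fixpoint free_vars (L : language) (p : preformula L) : set nat :=
  match p with
  | FEq x y => [set x; y]
  | FRel r v => [set x | x \in v]
  | FNot p => free_vars p
  | FConj k f => \bigcup_(i in [set: family_index k]) free_vars (f i)
  | FDisj k f => \bigcup_(i in [set: family_index k]) free_vars (f i)
  | FEx x p => free_vars p `\ x
  | FAll x p => free_vars p `\ x
  end.

Fixpoint is_formula (L : language) (p : preformula L) : Prop :=
  match p with
  | FEq _ _ => True
  | FRel _ _ => True
  | FNot p => is_formula p
  | FConj k f => finite_set (free_vars (FConj k f)) /\
                 forall i, is_formula (f i)
  | FDisj k f => finite_set (free_vars (FDisj k f)) /\
                 forall i, is_formula (f i)
  | FEx _ p => is_formula p
  | FAll _ p => is_formula p
  end.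

Definition sentence (L : language) (p : preformula L) : Prop :=
  is_formula p /\ free_vars p = set0.

Definition update (T : Type) (e : nat -> T) (x : nat) (a : T) : nat -> T :=
  fun y => if y == x then a else e y.

Fixpoint sat (L : language) (M : structure L) (e : nat -> M)
    (p : preformula L) : Prop :=
  match p with
  | FEq x y => e x = e y
  | FRel r v => rel_interp (map_tuple e v)
  | FNot p => ~ sat e p
  | FConj k f => forall i, sat e (f i)
  | FDisj k f => exists i, sat e (f i)
  | FEx x p => exists a, sat (update e x a) p
  | FAll x p => forall a, sat (update e x a) p
  end.

(* Only used for sentences, whose truth does not depend on the assignment;
   since carriers are inhabited, assignments exist. *)
Definition models (L : language) (M : structure L) (p : preformula L) : Prop :=
  forall e : nat -> M, sat e p.

Definition models_theory (L : language) (M : structure L)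
    (T : set (preformula L)) : Prop :=
  forall p, T p -> models M p.

Definition fresh (x : nat) (A : set nat) : nat :=
  if x \in A then xget 0 (~` A) else x.

(* Simultaneous capture-avoiding substitution of variables for free variables.
   Bound variables are renamed only when they would capture, and to a
   determined fresh variable.  Hence a formula has only countably many
   substitution instances: closing under all renamings of bound variables
   would instead produce uncountably many variants of an infinite
   conjunction. *)
Fixpoint subst (L : language) (s : nat -> nat) (p : preformula L) :
    preformula L :=
  match p with
  | FEq x y => FEq (s x) (s y)
  | FRel r v => FRel r (map_tuple s v)
  | FNot p => FNot (subst s p)
  | FConj k f => FConj k (fun i => subst s (f i))
  | FDisj k f => FDisj k (fun i => subst s (f i))
  | FEx x p => let z := fresh x (s @` (free_vars p `\ x)) in
               FEx z (subst (update s x z) p)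
  | FAll x p => let z := fresh x (s @` (free_vars p `\ x)) in
                FAll z (subst (update s x z) p)
  end.

Fixpoint subformulas (L : language) (p : preformula L) : set (preformula L) :=
  p |` match p with
       | FEq _ _ => set0
       | FRel _ _ => set0
       | FNot q => subformulas q
       | FConj k f => \bigcup_(i in [set: family_index k]) subformulas (f i)
       | FDisj k f => \bigcup_(i in [set: family_index k]) subformulas (f i)
       | FEx _ q => subformulas q
       | FAll _ q => subformulas q
       end.

Record fragment (L : language) (F : set (preformula L)) : Prop := Fragment {
  fragment_formula : forall p, F p -> is_formula p;
  fragment_eq : forall x y, F (FEq x y);
  fragment_rel : forall (r : L) (v : (arity r).-tuple nat), F (FRel r v);
  fragment_sub : forall p q, F p -> subformulas p q -> F q;
  fragment_not : forall p, F p -> F (FNot p);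
  fragment_conj : forall n (f : 'I_n -> preformula L),
    (forall i, F (f i)) -> F (FConj (Some n) f);
  fragment_disj : forall n (f : 'I_n -> preformula L),
    (forall i, F (f i)) -> F (FDisj (Some n) f);
  fragment_ex : forall x p, F p -> F (FEx x p);
  fragment_all : forall x p, F p -> F (FAll x p);
  fragment_subst : forall s p, F p -> F (subst s p)
}.

(** * The space of structures on nat *)

Definition Str (L : language) : Type :=
  forall r : L, (arity r).-tuple nat -> Prop.

Definition nat_structure (L : language) (M : Str L) : structure L :=
  Structure (inhabits 0) M.

Definition basic_clopen (L : language) : set (set (Str L)) :=
  [set X | exists (r : L) (a : (arity r).-tuple nat),
     X = [set M | M r a] \/ X = [set M | ~ M r a]].

HB.instance Definition _ (L : language) := gen_eqMixin (Str L).
HB.instance Definition _ (L : language) := gen_choiceMixin (Str L).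
HB.instance Definition _ (L : language) :=
  isPointed.Build (Str L) (fun _ _ => True).
HB.instance Definition _ (L : language) :=
  @isSubBaseTopological.Build (Str L) (set (Str L)) (@basic_clopen L) id.

Notation BorelStr L := (g_sigma_algebraType (@open (Str L))).

(* The structure obtained from [M] by moving each point [x] to [s x]. *)
Definition logic_action (L : language) (s : nat -> nat) (M : Str L) : Str L :=
  fun r a => exists2 b : (arity r).-tuple nat, a = map_tuple s b & M r b.

Definition orbit (L : language) (M : Str L) : set (Str L) :=
  [set N | exists2 s : nat -> nat, bijective s & N = logic_action s M].

Section Measures.
Context (R : realType) (L : language).

(* Measures in the library are functions on all subsets, determined only on
   the measurable ones.  The sets to which [mu] is applied below are Borel when
   [L] is countable, for orbits by a theorem of Scott and for the sets of
   models of sentences by an easy induction. *)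
Implicit Type mu : probability (BorelStr L) R.

Definition invariant mu : Prop :=
  forall X : set (BorelStr L), measurable X ->
  forall s : nat -> nat, bijective s -> mu (@logic_action L s @` X) = mu X.

Definition ergodic mu : Prop :=
  forall X : set (BorelStr L), measurable X ->
    (forall s : nat -> nat, bijective s ->
       mu (X `+` (@logic_action L s @` X)) = 0%E) ->
    mu X = 0%E \/ mu X = 1%E.

Definition ergodic_structure mu : Prop := invariant mu /\ ergodic mu.

Definition properly_ergodic mu : Prop :=
  ergodic_structure mu /\ forall M : Str L, mu (orbit M) = 0%E.

Definition measure_models mu (p : preformula L) : Prop :=
  mu [set M : Str L | models (nat_structure M) p] = 1%E.

Definition Th mu : set (preformula L) :=
  [set p | sentence p /\ measure_models mu p].

Definition ThF (F : set (preformula L)) mu : set (preformula L) := Th mu `&` F.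

End Measures.

(* The isomorphism classes of countable models of [T] are in bijection with
   2^nat: [M] is a complete and irredundant system of representatives. *)
Definition continuum_many_countable_models (L : language)
    (T : set (preformula L)) : Prop :=
  exists M : (nat -> bool) -> structure L,
    [/\ forall c, countable [set: M c] /\ models_theory (M c) T,
        forall c c', isomorphic (M c) (M c') -> c = c'
      & forall N : structure L, countable [set: N] -> models_theory N T ->
          exists c, isomorphic N (M c)].

(* Main.v *)
Require Import Defs.
From HB Require Import structures.
From mathcomp Require Import all_boot all_order all_algebra.
From mathcomp Require Import all_classical all_reals all_analysis.

Set Implicit Arguments.
Unset Strict Implicit.
Unset Printing Implicit Defensive.

Import Order.TTheory GRing.Theory Num.Theory.

Local Open Scope classical_set_scope.

(** Write [Mod s p] for the set of structures on nat satisfying the formula [p]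
    when the variable [x_i] is interpreted by the number [s i], and let S_n be
    the sigma-algebra of the sets [Mod id p], where [p] ranges over the formulas
    whose free variables are among the first [n].  By invariance, replacing [id]
    by another bijection [s] does not change the measure of such a set, so that
    S_n describes injective [n]-tuples at arbitrary positions.

    In any probability space, a sigma-algebra of measurable sets satisfies one
    of two alternatives ([small_or_unsplit]): either some set of positive
    measure is covered, for every [k], by countably many members of measure
    less than 1/(k+1), or almost all of the space is covered by countably many
    members that no other member splits into two parts of positive measure.

    If the second alternative held for all S_n, then almost surely any two
    injective tuples satisfying a common unsplittable formula would have the
    same extensions, as far as unsplittable formulas can tell.  Countably many
    formulas witness this; they act as a Scott sentence: the structures
    satisfying all of them form, by back and forth, exactly one orbit, and it
    has measure one ([orbit_full]).  This contradicts proper ergodicity, so for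
    some [n] there are formulas [phi k i] with [Mod id (phi k i)] of measure less
    than 1/(k+1) such that the conjunction [beta] over [k] of the disjunctions
    over [i] of [phi k i] has positive measure ([small_covers]).

    By ergodicity, the theory contains the sentence saying that some injective
    tuple satisfies [beta].  In a model, of any cardinality, such a tuple
    satisfies the conjunction over [k] of [phi k (j k)] for some choice [j].  That
    conjunction is a null formula, so the theory also says that no injective
    tuple satisfies it.  Hence there is no model ([Th_no_model]).

    For a countable fragment F, a binary tree of sets of positive measure is
    built inside [beta].  Along each branch every formula of F and every
    subformula of the [phi k i] is decided for every assignment, together with a
    witness whenever an existential statement is decided positively (or a
    universal one negatively).  The branch therefore determines a generic
    structure in which truth is what the branch decides; it is a model of the
    F-theory because a set of measure one cannot be decided negatively.  The
    members of [beta] being covered by arbitrarily small [phi k i], every set in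
    the tree can also be split into two positive parts by some [phi k i], so that
    distinct branches give the tuple (0, ..., n-1) distinct types
    ([many_models]).  A countable structure has only countably many [n]-tuples,
    so it is isomorphic to the generic structures of only countably many
    branches.  A diagonal argument in the style of Koenig's theorem on
    cardinals ([cantor_space_injects]) turns this into an injection of the
    Cantor space into the isomorphism classes, and the Cantor-Bernstein theorem
    gives the bijection ([continuum_many]). *)

(** * Countability and bijections of nat *)

Lemma countableU (T : Type) (A B : set T) :
  countable A -> countable B -> countable (A `|` B).
Proof.
move=> cA cB; rewrite (_ : A `|` B = \bigcup_(b in [set: bool]) if b then A else B).
  by apply: bigcup_countable => // -[].
apply/seteqP; split=> [x [?|?]|x [[] _ ?]]; [by exists true|by exists false|by left|by right].
Qed.

Lemma enumerate (T : Type) (A : set T) a : countable A -> A a ->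
  exists2 f : nat -> T, (forall k, A (f k)) & forall x, A x -> exists k, f k = x.
Proof.
move=> /countable_injP[g ginj] Aa.
have /choice[f fP] : forall k, exists x, A x /\ forall y, A y -> g y = k -> y = x.
  move=> k; have [[x Ax gx]|nx] := pselect (exists2 x, A x & g x = k).
    by exists x; split=> // y Ay gy; apply: ginj; rewrite ?inE ?gx.
  by exists a; split=> // y Ay gy; case: nx; exists y.
exists f => [k|x Ax]; first by have [] := fP k.
by exists (g x); have [_ /(_ x Ax erefl)] := fP (g x).
Qed.

Lemma bijective_of_inj_surj (T U : Type) (f : T -> U) :
  injective f -> (forall y, exists x, f x = y) -> bijective f.
Proof.
by move=> injf /choice[g gK]; exists g => // x; apply: injf; rewrite gK.
Qed.

Definition inj_below (T : Type) n (e : nat -> T) : Prop :=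
  forall i j, j < i < n -> e j <> e i.

Lemma bij_inj_below n (s : nat -> nat) : bijective s -> inj_below n s.
Proof. by move=> /bij_inj injs i j /andP[ji _] /injs eji; rewrite eji ltnn in ji. Qed.

(** Composing [s] with the transposition of [n] and the preimage of [y] leaves
    the values below [n] unchanged, because that preimage is at least [n]. *)
Lemma bij_step n (s : nat -> nat) y : bijective s ->
  (forall i, i < n -> s i <> y) ->
  exists s' : nat -> nat,
    [/\ bijective s', forall i, i < n -> s' i = s i & s' n = y].
Proof.
move=> [t sK tK] ny.
have nt : n <= t y by rewrite leqNgt; apply/negP => /ny; rewrite tK.
pose w x := if x == n then t y else if x == t y then n else x.
have wK : involutive w.
  move=> x; rewrite /w; case: (eqVneq x n) => [->|xn]; last first.
    by case: (eqVneq x (t y)) => [->|xt]; rewrite ?eqxx ?(negPf xn) ?(negPf xt).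
  by case: (eqVneq (t y) n) => [//|tn]; rewrite eqxx.
exists (s \o w); split => [|i i_n|].
- by apply: bij_comp; [exists t|exact: inv_bij].
- rewrite /= /w; case: eqP => [ein|_]; first by rewrite ein ltnn in i_n.
  by case: eqP => // eit; rewrite eit ltnNge nt in i_n.
- by rewrite /= /w eqxx tK.
Qed.

Lemma bij_extend n (e : nat -> nat) : inj_below n e ->
  exists2 s : nat -> nat, bijective s & forall i, i < n -> s i = e i.
Proof.
elim: n => [|n IH] inj_e; first by exists id; first exact: (inv_bij (fun=> erefl)).
have [|s bs se] := IH.
  by move=> i j /andP[ji i_n]; apply: inj_e; rewrite ji ltnW.
have [|s' [bs' ss' s'n]] := @bij_step n s (e n) bs.
  by move=> i i_n; rewrite se //; apply: inj_e; rewrite i_n /=.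
exists s' => // i; rewrite ltnS leq_eqVlt => /orP[/eqP->//|i_n].
by rewrite ss' ?se.
Qed.

Lemma map_tuple_comp (T U V : Type) n (f : U -> V) (g : T -> U) (a : n.-tuple T) :
  map_tuple f (map_tuple g a) = map_tuple (f \o g) a.
Proof. by apply: val_inj => /=; rewrite -map_comp. Qed.

Lemma map_tuple_id (T : Type) n (f : T -> T) (a : n.-tuple T) :
  (forall x, f x = x) -> map_tuple f a = a.
Proof. by move=> fE; apply: val_inj => /=; rewrite -[RHS]map_id; exact: eq_map. Qed.

(** Koenig's argument: the Cantor space is identified with its [I]-th power.  If no
    [g i] hit every value of the [i]-th coordinate, a point missed by [g i] in its
    [i]-th coordinate, for all [i] at once, would be missed by all the [g i].  So
    some coordinate of some [g i] maps [Q] onto the Cantor space.  This does the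
    work of the cardinal equality stating that an infinite set is equinumerous with
    its product with a countable one. *)
Lemma cantor_space_injects (I : countType) (Q : set (nat -> bool)) (g : I -> (nat -> bool) -> nat -> bool) :
  (forall c, exists i q, Q q /\ g i q = c) ->
  exists2 h : (nat -> bool) -> nat -> bool, injective h & forall c, Q (h c).
Proof.
move=> gP; pose p (c : nat -> bool) (i : I) (k : nat) := c (pickle (i, k)).
have [i /choice[h hP]] : exists i, forall y, exists q, Q q /\ p (g i q) i = y.
  apply: contrapT => /forallNP H.
  have /choice[y yP] : forall i, exists y, forall q, Q q -> p (g i q) i <> y.
    move=> i; have /existsNP[y yP] := H i; exists y => q Qq pE.
    by apply: yP; exists q.
  (* Its [i]-th coordinate is [y i]. *)
  pose c m := if unpickle m is Some (i, k) then y i k else false.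
  have [i [q [Qq gc]]] := gP c; apply: (yP i q Qq).
  by rewrite gc; apply/funext => k; rewrite /p /c pickleK.
exists h => [c c' cc'|c]; last by have [] := hP c.
by have [_ <-] := hP c; have [_ <-] := hP c'; rewrite cc'.
Qed.

(** * Small sets and unsplittable sets of a probability space *)

Section Exhaustion.
Context d (T : measurableType d) (R : realType) (mu : probability T R).
Local Open Scope ring_scope.

Lemma mu_gt0 (A : set T) : mu A != 0%E -> (0 < mu A)%E.
Proof. by move=> A0; rewrite lt0e A0 measure_ge0. Qed.

Lemma null_bigcup (F : nat -> set T) :
  (forall k, measurable (F k)) -> (forall k, mu (F k) = 0%E) ->
  mu (\bigcup_k F k) = 0%E.
Proof.
move=> mF F0; apply: measure_negligible; first exact: bigcupT_measurable.
by apply: negligible_bigcup => k; apply: (negligibleP _ (mF k)).2; apply: F0.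
Qed.

Lemma null_subset (A B : set T) : measurable A -> measurable B ->
  A `<=` B -> mu B = 0%E -> mu A = 0%E.
Proof. exact: subset_measure0. Qed.

Lemma full_setC (A : set T) : measurable A -> mu (~` A) = 0%E -> mu A = 1%E.
Proof.
move=> mA A0; rewrite -[A]setCK probability_setC ?A0 ?sube0 //.
exact: measurableC.
Qed.

Lemma fine_measureD (A B : set T) : measurable A -> measurable B ->
  fine (mu A) = fine (mu (A `\` B)) + fine (mu (A `&` B)).
Proof.
move=> mA mB.
have mD : measurable (A `\` B) by exact: measurableD.
have mI : measurable (A `&` B) by exact: measurableI.
by rewrite (measureDI _ mA mB) fineD // fin_num_measure.
Qed.

Lemma fine_le_measure (A B : set T) : measurable A -> measurable B ->
  A `<=` B -> fine (mu A) <= fine (mu B).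
Proof.
by move=> mA mB AB; rewrite fine_le ?fin_num_measure// le_measure ?inE.
Qed.

Lemma fine_gt0_measure (A : set T) : measurable A -> mu A <> 0%E ->
  0 < fine (mu A).
Proof.
move=> mA /eqP A0; rewrite fine_gt0 // mu_gt0 //= ltey_eq.
by rewrite fin_num_measure.
Qed.

(** The measures of countable unions of members of [G] have a supremum, which is
    attained by merging maximizing sequences into a single one; a member adding
    positive measure to the union would exceed it. *)
Lemma exhaustion (G : set (set T)) :
  G set0 -> (forall A, G A -> measurable A) ->
  exists2 U : nat -> set T, forall k, G (U k) &
    forall A, G A -> mu (A `\` \bigcup_k U k) = 0%E.
Proof.
move=> G0 mG.
pose seqs := [set U : nat -> set T | forall k, G (U k)].
have mU U : seqs U -> measurable (\bigcup_k U k).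
  by move=> sU; apply: bigcupT_measurable => k; exact/mG/sU.
pose E : set R := [set fine (mu (\bigcup_k U k)) | U in seqs].
have supE : has_sup E.
  split; first by eexists; exists (fun=> set0).
  exists 1 => _ [U sU <-].
  by rewrite -lee_fin fineK ?fin_num_measure ?probability_le1 //; exact: mU.
have /choice[V VP] : forall j, exists V : nat -> set T,
    seqs V /\ sup E - j.+1%:R^-1 < fine (mu (\bigcup_k V k)).
  move=> j; have [|_ [V sV <-] ltV] := sup_adherent (eps := j.+1%:R^-1) _ supE.
    by rewrite invr_gt0.
  by exists V.
pose U n := if unpickle n is Some (j, k) then V j k else set0.
have sU : seqs U.
  by move=> n; rewrite /U; case: (unpickle n) => [[j k]|] //; apply (VP j).1.
exists U => // A GA.
have mA := mG A GA.
apply: contrapT => A0.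
have mUU := mU _ sU.
have c0 : 0 < fine (mu (A `\` \bigcup_k U k)).
  by apply: fine_gt0_measure => //; exact: measurableD.
(* Adding [A] to the sequence would push the measure of the union above [sup E]. *)
pose W k := if k is k'.+1 then U k' else A.
have sW : seqs W by case.
have WE : \bigcup_k W k = A `|` \bigcup_k U k.
  apply/seteqP; split => [x [[|k] _ Wx]|x [Ax|[k _ Ux]]]; [by left| |by exists 0%N|by exists k.+1].
  by right; exists k.
have : fine (mu (\bigcup_k W k)) <= sup E.
  by apply: ub_le_sup; [exact: supE.2|exists W].
rewrite leNgt => /negP; apply.
have [j ltj] := ltr_add_invr c0; rewrite add0r in ltj.
have [sV] := VP j; rewrite ltrBlDr => /lt_le_trans; apply.
have VU : \bigcup_k V j k `<=` \bigcup_k U k.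
  by move=> x [k _ Vx]; exists (pickle (j, k)); rewrite // /U pickleK.
have mW : measurable (A `|` \bigcup_k U k) by exact: measurableU.
rewrite WE (fine_measureD mW mUU).
rewrite addrC lerD //.
- rewrite ltW // (lt_le_trans ltj) // fine_le_measure //; try exact: measurableD.
  by apply: setSD; left.
- apply: fine_le_measure; [exact: mU|exact: measurableI|].
  by move=> x /VU Ux; split => //; right.
Qed.

(** Null sets qualify, so that the unsplit sets form a family containing the
    empty set, to which [exhaustion] applies. *)
Definition unsplit (S : set (set T)) (X : set T) : Prop :=
  S X /\ forall Y, S Y -> mu (X `&` Y) = 0%E \/ mu (X `\` Y) = 0%E.

(** Exhaust the space by the members of measure less than 1/(k+1), for each [k],
    and by the unsplit members.  If the second alternative fails and almost no
    point is in small members for all [k], some positive member [D] of [S] contains,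
    for one [k], neither positive members of measure less than 1/(k+1) nor positive
    unsplit ones.  A positive member of [D] whose measure is within 1/(k+1) of the
    infimum of such measures then splits into two positive parts, one of measure at
    least the infimum and the other of measure at least 1/(k+1), which is too much. *)
Lemma small_or_unsplit (S : set (set T)) :
  (forall A, S A -> measurable A) -> S set0 ->
  (forall A, S A -> S (~` A)) ->
  (forall A : nat -> set T, (forall k, S (A k)) -> S (\bigcup_k A k)) ->
  (exists A : nat -> nat -> set T,
     (forall k i, S (A k i) /\ fine (mu (A k i)) < k.+1%:R^-1) /\
     mu (\bigcap_k \bigcup_i A k i) <> 0%E) \/
  (exists X : nat -> set T,
     (forall i, unsplit S (X i)) /\ mu (~` \bigcup_i X i) = 0%E).
Proof.
move=> mS S0 SC SU.
have SI A B : S A -> S B -> S (A `&` B).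
  move=> SA SB; rewrite -[A]setCK -[B]setCK -setCU; apply: (SC).
  rewrite (_ : _ `|` _ = \bigcup_k (if k is 0%N then ~` A else ~` B)).
    by apply: SU => -[|k]; exact: SC.
  apply/seteqP; split => [x [|] nx|x [[|k] _ nx]];
    by [exists 0%N|exists 1%N|left|right].
have SD A B : S A -> S B -> S (A `\` B) by move=> SA SB; apply: SI => //; exact: SC.
pose small k := [set A | S A /\ fine (mu A) < k.+1%:R^-1].
have /choice[A AP] : forall k, exists A : nat -> set T,
    (forall i, small k (A i)) /\
    forall B, small k B -> mu (B `\` \bigcup_i A i) = 0%E.
  move=> k; have [|B [/mS //]|A ? ?] := @exhaustion (small k).
    by split=> //; rewrite measure0 invr_gt0.
  by exists A.
have SAi k : S (\bigcup_i A k i).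
  by apply: SU => i; exact: ((AP k).1 i).1.
have [B0|B0] := pselect (mu (\bigcap_k \bigcup_i A k i) = 0%E); last first.
  by left; exists A; split=> // k i; exact: (AP k).1.
right.
have [|X [/mS //]|X XP Xmax] := @exhaustion (unsplit S).
  by split=> // Y _; left; rewrite set0I measure0.
exists X; split => //.
have SX : S (\bigcup_i X i) by apply: SU => i; exact: (XP i).1.
apply: contrapT => W0.
pose D k := (~` \bigcup_i X i) `\` \bigcup_i A k i.
have SDk k : S (D k) by apply: SD => //; exact: SC.
have [k Dk0] : exists k, mu (D k) <> 0%E.
  apply: contrapT => D0; apply: W0.
  apply: (@null_subset _ (\bigcap_k \bigcup_i A k i `|` \bigcup_k D k)).
  - exact/mS/SC.
  - apply: measurableU; last by apply: bigcupT_measurable => k; exact/mS.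
    by apply: bigcapT_measurable => k; exact/mS.
  - move=> x nx; have [?|/existsNP[k Ak]] := pselect (forall k, (\bigcup_i A k i) x).
      by left=> k _.
    by right; exists k => //; split=> // ?; apply: Ak.
  - rewrite measureU0 //.
    + by apply: bigcapT_measurable => k; exact/mS.
    + by apply: bigcupT_measurable => k; exact/mS.
    + apply: null_bigcup => k; first exact/mS.
      by apply: contrapT => Dk; apply: D0; exists k.
pose pos := [set C | [/\ S C, C `<=` D k & mu C <> 0%E]].
pose E : set R := [set fine (mu C) | C in pos].
have infE : has_inf E.
  split; first by exists (fine (mu (D k))), (D k); split.
  by exists 0 => _ [C _ <-]; rewrite fine_ge0.
have inf_le C : pos C -> inf E <= fine (mu C).
  by move=> pC; apply: ge_inf; [exact: infE.2|exists C].
(* A smaller member would be almost covered by the sets [A k i], which [D k]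
   avoids. *)
have ge_k C : pos C -> k.+1%:R^-1 <= fine (mu C).
  move=> [SC' CD C0]; rewrite leNgt; apply/negP => ltC; apply: C0.
  rewrite -((AP k).2 C) //; congr (mu _).
  by apply/seteqP; split => [x Cx|x []] //; split => //; have [] := CD x Cx.
have [|_ [C pC <-] ltC] := inf_adherent (eps := k.+1%:R^-1) _ infE.
  by rewrite invr_gt0.
have [SC' CD C0] := pC.
have /not_andP[//|/existsNP[Y /not_implyP[SY /not_orP[CY0 CD0]]]] : ~ unsplit S C.
  move=> uC; apply: C0; rewrite -(Xmax C uC); congr (mu _).
  by apply/seteqP; split => [x Cx|x []] //; split => //; have [] := CD x Cx.
move: ltC; rewrite ltNge => /negP; apply.
rewrite (fine_measureD (mS _ SC') (mS _ SY)).
rewrite addrC lerD //.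
  by apply: ge_k; split; [exact: SD|move=> x [] /CD|].
by apply: inf_le; split; [exact: SI|move=> x [] /CD|].
Qed.
End Exhaustion.

(** * Satisfaction, isomorphisms and the logic action *)

Lemma update_comp (T U : Type) (f : T -> U) (e : nat -> T) x a :
  update (f \o e) x (f a) = f \o update e x a.
Proof. by apply/funext => y; rewrite /update /=; case: ifP. Qed.

Lemma sat_agree (L : language) (M : structure L) (p : preformula L)
    (e e' : nat -> M) :
  (forall x, free_vars p x -> e x = e' x) -> sat e p <-> sat e' p.
Proof.
elim: p e e' => /=.
- by move=> x y e e' ee; rewrite !ee //; [right|left].
- move=> r v e e' ee; rewrite (_ : map_tuple e v = map_tuple e' v) //.
  by apply/val_inj/eq_in_map => x xv; exact: ee.
- by move=> p IH e e' ee; rewrite (IH e e' ee).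
- move=> k f IH e e' ee.
  have IHi i : sat e (f i) <-> sat e' (f i).
    by apply: IH => x fx; apply: ee; exists i.
  by split => H i; apply/IHi/H.
- move=> k f IH e e' ee.
  have IHi i : sat e (f i) <-> sat e' (f i).
    by apply: IH => x fx; apply: ee; exists i.
  by split => -[i H]; exists i; apply/IHi.
- move=> x p IH e e' ee.
  have IHa a : sat (update e x a) p <-> sat (update e' x a) p.
    by apply: IH => y fy; rewrite /update; case: eqP => // yx; apply: ee.
  by split => -[a H]; exists a; apply/IHa.
- move=> x p IH e e' ee.
  have IHa a : sat (update e x a) p <-> sat (update e' x a) p.
    by apply: IH => y fy; rewrite /update; case: eqP => // yx; apply: ee.
  by split => H a; apply/IHa/H.
Qed.

Lemma sat_agreeW (L : language) (M : structure L) (p : preformula L)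
    (e e' : nat -> M) :
  (forall x, free_vars p x -> e x = e' x) -> sat e p -> sat e' p.
Proof. by move=> ee; apply: (sat_agree ee).1. Qed.

Lemma sat_iso (L : language) (M N : structure L) (f : M -> N) :
  bijective f ->
  (forall r (a : (arity r).-tuple M),
     rel_interp a <-> rel_interp (map_tuple f a)) ->
  forall (p : preformula L) (e : nat -> M), sat (f \o e) p <-> sat e p.
Proof.
move=> [g fK gK] fM; elim => /=.
- by move=> x y e; split => [/(can_inj fK)|->].
- move=> r v e; rewrite fM; set a := map_tuple _ _; set b := map_tuple _ _.
  rewrite (_ : a = b) //; apply: val_inj => /=.
  by rewrite -map_comp.
- by move=> p IH e; rewrite IH.
- by move=> k h IH e; split => H i; apply/IH/H.
- by move=> k h IH e; split => -[i H]; exists i; apply/IH/H.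
- move=> x p IH e; split => -[a H].
    by exists (g a); apply/IH; rewrite -update_comp gK.
  by exists (f a); rewrite update_comp; apply/IH.
- move=> x p IH e; split => H a.
    by apply/IH; rewrite -update_comp.
  by rewrite -[a]gK update_comp; apply/IH.
Qed.

Lemma countable_family k : countable [set: family_index k].
Proof. by case: k => [n|]; [exact: (@countableP 'I_n)|exact: (@countableP nat)]. Qed.

Section Str.
Context (L : language).
Implicit Types (M N : Str L) (p : preformula L) (e s : nat -> nat).

Definition Mod e p : set (BorelStr L) :=
  [set M : Str L | @sat L (nat_structure M) e p].

Lemma Mod_agree e e' p : (forall x, free_vars p x -> e x = e' x) ->
  Mod e p = Mod e' p.
Proof. by move=> ee; apply/funext => M; apply/propext; exact: sat_agree. Qed.

Lemma Mod_measurable e p : is_formula p -> measurable (Mod e p).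
Proof.
elim: p e => /=.
- move=> x y e _; have [exy|nexy] := pselect (e x = e y).
    by rewrite (_ : Mod _ _ = setT) //; apply/seteqP; split.
  by rewrite (_ : Mod _ _ = set0) //; apply/seteqP; split.
- move=> r v e _; apply: sub_sigma_algebra.
  exists [set Mod e (FRel r v)]; last by rewrite bigcup_set1.
  by move=> _ ->; apply: finI_from1; exists r, (map_tuple e v); left.
- by move=> p IH e /IH mp; apply: measurableC; exact: mp.
- move=> k f IH e [_ fp].
  rewrite (_ : Mod _ _ = \bigcap_i Mod e (f i)); last first.
    by apply/seteqP; split => M H i => [_|]; exact: (H i).
  rewrite -[\bigcap_i _]setCK setC_bigcap.
  apply: measurableC; apply: countable_bigcupT_measurable.
    exact: countable_family.
  by move=> i; apply: measurableC; exact: IH.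
- move=> k f IH e [_ fp].
  rewrite (_ : Mod _ _ = \bigcup_i Mod e (f i)); last first.
    by apply/seteqP; split => M [i] => [H|_ H]; exists i.
  apply: countable_bigcupT_measurable.
    exact: countable_family.
  by move=> i; exact: IH.
- move=> x p IH e fp.
  rewrite (_ : Mod _ _ = \bigcup_a Mod (update e x a) p); last first.
    by apply/seteqP; split => M [a] => [H|_ H]; exists a.
  by apply: bigcupT_measurable => a; exact: IH.
- move=> x p IH e fp.
  rewrite (_ : Mod _ _ = \bigcap_a Mod (update e x a) p); last first.
    by apply/seteqP; split => M H a; [move=> _|]; exact: H.
  by apply: bigcapT_measurable => a; exact: IH.
Qed.

(** The inverse of [logic_action s] when [s] is bijective; in this direction
    satisfaction is obtained by composing assignments with [s]. *)
Definition pull M s : Str L := fun r b => M r (map_tuple s b).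

Lemma sat_pull M s e p : bijective s ->
  @sat L (nat_structure (pull M s)) e p <->
  @sat L (nat_structure M) (s \o e) p.
Proof.
move=> bs; apply: iff_sym.
exact: (@sat_iso L (nat_structure (pull M s)) (nat_structure M) s).
Qed.

Lemma logic_action_pull M s : bijective s -> logic_action s (pull M s) = M.
Proof.
move=> [t sK tK]; apply: functional_extensionality_dep => r; apply/funext => a; apply/propext.
split => [[b -> //]|Ma]; exists (map_tuple t a); rewrite ?/pull map_tuple_comp map_tuple_id //.
Qed.

Lemma pull_logic_action M s : bijective s -> pull (logic_action s M) s = M.
Proof.
move=> /bij_inj injs; apply: functional_extensionality_dep => r; apply/funext => a; apply/propext.
rewrite /pull; split => [[b ab Mb]|Ma]; last by exists a.
by rewrite (_ : a = b) //; apply/val_inj/(inj_map injs)/(congr1 val ab).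
Qed.

Lemma logic_action_Mod s p : bijective s ->
  @logic_action L s @` Mod id p = Mod s p.
Proof.
move=> bs; apply/seteqP; split => [_ [N Np <-]|M Mp].
  have := sat_pull (logic_action s N) id p bs; rewrite pull_logic_action //.
  by move=> H; apply/H.
exists (pull M s); last exact: logic_action_pull.
by apply/(sat_pull M id p bs).
Qed.

Section Invariant.
Context (R : realType) (mu : probability (BorelStr L) R).

Lemma mu_Mod s p : Defs.invariant mu -> is_formula p -> bijective s ->
  mu (Mod s p) = mu (Mod id p).
Proof.
by move=> inv fp bs; rewrite -logic_action_Mod // inv //; exact: Mod_measurable.
Qed.

Lemma Mod_sentence e e' p : free_vars p = set0 -> Mod e p = Mod e' p.
Proof. by move=> p0; apply: Mod_agree => x; rewrite p0. Qed.

Lemma models_Mod e p : free_vars p = set0 ->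
  [set M : Str L | models (nat_structure M) p] = Mod e p.
Proof.
move=> p0; apply/seteqP; split => M Mp; first exact: Mp.
by move=> e'; apply: (sat_agree _).1 Mp => x; rewrite p0.
Qed.

(** The models of a sentence form an invariant set, to which ergodicity applies. *)
Lemma zero_one p e : Defs.ergodic mu -> sentence p -> mu (Mod e p) = 0%E \/ mu (Mod e p) = 1%E.
Proof.
move=> erg [fp p0]; apply: erg; first exact: Mod_measurable.
move=> s bs; rewrite (Mod_sentence e id p0) logic_action_Mod //.
by rewrite (Mod_sentence s id p0) setYK measure0.
Qed.
End Invariant.
End Str.

(** * Formulas in the first n variables *)

Section Formulas.
Context (L : language).
Implicit Types (p q : preformula L).

Definition FAnd p q : preformula L := FConj None (fun k => if k is 0 then p else q).
Definition FFalse : preformula L := FDisj (Some 0) (fun=> FEq 0 0).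
Definition distinct n : preformula L :=
  FConj (Some n) (fun i => FConj (Some (val i)) (fun j => FNot (FEq (val j) (val i)))).
Fixpoint exs n p := if n is n'.+1 then exs n' (FEx n' p) else p.
(** Injectivity of the tuple is what makes the sentence, for structures on nat, a
    statement about bijections of nat, whatever the behaviour of [p] on tuples with
    repetitions. *)
Definition exists_distinct n p := exs n (FAnd (distinct n) p).

Definition nform n p := is_formula p /\ free_vars p `<=` `I_n.

Lemma sat_FAnd (M : structure L) (e : nat -> M) p q :
  sat e (FAnd p q) <-> sat e p /\ sat e q.
Proof. by split=> [H|[ep eq] [|]//]; split; [exact: (H 0)|exact: (H 1)]. Qed.

Lemma sat_distinct (M : structure L) (e : nat -> M) n :
  sat e (distinct n) <-> inj_below n e.
Proof.
split=> [H i j /andP[ji i_n]|H i j]; first exact: (H (Ordinal i_n) (Ordinal ji)).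
by apply: H; rewrite ltn_ord /=.
Qed.

Lemma sat_exs (M : structure L) (e : nat -> M) n p :
  sat e (exs n p) <-> exists2 e' : nat -> M, (forall x, n <= x -> e' x = e x) & sat e' p.
Proof.
elim: n p => [|n IH] p /=.
  split=> [ep|[e' ee' e'p]]; first by exists e.
  by apply: (sat_agreeW _ e'p) => x _; rewrite ee'.
rewrite IH; split => [[e' ee' [a e'p]]|[e' ee' e'p]].
  exists (update e' n a) => // x nx; rewrite /update; case: eqP => [xn|_].
    by rewrite xn ltnn in nx.
  by rewrite ee' // ltnW.
exists (update e' n (e n)).
  move=> x; rewrite leq_eqVlt /update => /orP[/eqP<-|nx]; rewrite ?eqxx //.
  by rewrite gtn_eqF // ee'.
exists (e' n); apply: (sat_agreeW _ e'p) => x _.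
by rewrite /update; case: eqP => // ->.
Qed.

Lemma nform_FNot n p : nform n p -> nform n (FNot p).
Proof. by []. Qed.

Lemma nform_FConj n k f : (forall i, nform n (f i)) -> nform n (@FConj L k f).
Proof.
move=> nf; have sub : free_vars (FConj k f) `<=` `I_n.
  by move=> x [i _ fx]; apply: (nf i).2.
split=> //; split=> [|i]; last exact: (nf i).1.
exact: sub_finite_set sub (finite_II n).
Qed.

Lemma nform_FDisj n k f : (forall i, nform n (f i)) -> nform n (@FDisj L k f).
Proof.
move=> nf; have sub : free_vars (FDisj k f) `<=` `I_n.
  by move=> x [i _ fx]; apply: (nf i).2.
split=> //; split=> [|i]; last exact: (nf i).1.
exact: sub_finite_set sub (finite_II n).
Qed.

Lemma nform_FAnd n p q : nform n p -> nform n q -> nform n (FAnd p q).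
Proof. by move=> np nq; apply: nform_FConj => -[|k]. Qed.

Lemma nform_FFalse n : nform n FFalse.
Proof. by apply: nform_FDisj => -[]. Qed.

Lemma nform_FEx n p : nform n.+1 p -> nform n (FEx n p).
Proof.
move=> [fp np]; split=> // x [px xn]; have := np x px.
by rewrite /= ltnS leq_eqVlt => /orP[/eqP|].
Qed.

Lemma nform_distinct n : nform n (distinct n).
Proof.
apply: nform_FConj => i; apply: nform_FConj => j; split=> // x /= [|] -> //.
by rewrite /= (ltn_trans (ltn_ord j) (ltn_ord i)).
Qed.

Lemma nform_exs n p : nform n p -> sentence (exs n p).
Proof.
elim: n p => [|n IH] p np; first by split; [exact: np.1|apply/seteqP; split=> // x /np.2].
exact/IH/nform_FEx.
Qed.

Lemma sentence_exists_distinct n p : nform n p -> sentence (exists_distinct n p).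
Proof. by move=> np; apply/nform_exs/nform_FAnd => //; exact: nform_distinct. Qed.

Lemma sat_exists_distinct (M : structure L) (e : nat -> M) n p : nform n p ->
  sat e (exists_distinct n p) <-> exists2 e' : nat -> M, inj_below n e' & sat e' p.
Proof.
move=> np; rewrite sat_exs; split.
  by move=> [e' _ /sat_FAnd[/sat_distinct ? ?]]; exists e'.
move=> [e' inj_e' e'p].
pose e1 x := if x < n then e' x else e x.
have ee1 x : x < n -> e1 x = e' x by rewrite /e1 => ->.
exists e1; first by move=> x; rewrite /e1 ltnNge => ->.
apply/sat_FAnd; split.
  apply/sat_distinct => i j /andP[ji i_n].
  by rewrite !ee1 // ?(ltn_trans ji) //; apply: inj_e'; rewrite ji.
by apply: (sat_agreeW _ e'p) => x /np.2 /ee1.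
Qed.

(** An injective tuple of numbers extends to a bijection of nat. *)
Lemma Mod_exists_distinct (M : Str L) e n p : nform n p ->
  Mod e (exists_distinct n p) M <->
  exists2 s : nat -> nat, bijective s & Mod s p M.
Proof.
move=> np; rewrite [Mod _ _ _]sat_exists_distinct //; split.
  move=> [e' /bij_extend[s bs se] e'p]; exists s => //.
  by apply: (sat_agreeW _ e'p) => x /np.2 /se.
by move=> [s bs sp]; exists s => //; exact: bij_inj_below.
Qed.

Section Measure.
Context (R : realType) (mu : probability (BorelStr L) R).
Hypothesis mu_inv : Defs.invariant mu.

(** Although a structure has uncountably many bijections, only the values below
    [n] matter to [p], so countably many null sets [Mod s p] cover. *)
Lemma null_exists_distinct e n p : nform n p -> mu (Mod id p) = 0%E ->
  mu (Mod e (exists_distinct n p)) = 0%E.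
Proof.
move=> np p0.
(* A list [l] stands for all the bijections that start with [l]. *)
pose F k : set (BorelStr L) := if unpickle k is Some l then
  if `[< exists2 s : nat -> nat, bijective s & forall i, i < n -> s i = nth 0 l i >]
   then Mod (nth 0 l) p else set0 else set0.
have F0 k : measurable (F k) /\ mu (F k) = 0%E.
  rewrite /F; case: (unpickle k) => [l|]; last by rewrite measure0.
  case: asboolP => [[s bs sl]|_]; last by rewrite measure0.
  have -> : Mod (nth 0 l) p = Mod s p by apply: Mod_agree => x /np.2 /sl.
  by split; [exact: (Mod_measurable _ np.1)|rewrite (mu_Mod mu_inv np.1 bs)].
apply: (null_subset (B := \bigcup_k F k)).
- by apply: Mod_measurable; exact: (sentence_exists_distinct np).1.
- by apply: bigcupT_measurable => k; have [] := F0 k.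
- move=> M /(Mod_exists_distinct _ _ np)[s bs sp].
  exists (pickle (mkseq s n)) => //; rewrite /F pickleK asboolT.
    by apply: (sat_agreeW _ sp) => x /np.2 xn; rewrite nth_mkseq.
  by exists s => // i i_n; rewrite nth_mkseq.
- by apply: null_bigcup => k; have [] := F0 k.
Qed.

End Measure.

(** The sigma-algebra to which [small_or_unsplit] is applied. *)
Definition defsets n : set (set (BorelStr L)) := [set Mod id p | p in nform n].

Lemma defsets_measurable n A : defsets n A -> measurable A.
Proof. by move=> [p np <-]; apply: Mod_measurable; exact: np.1. Qed.

Lemma defsets0 n : defsets n set0.
Proof.
exists FFalse; first exact: nform_FFalse.
by apply/seteqP; split => // M [[]].
Qed.

Lemma defsetsC n A : defsets n A -> defsets n (~` A).
Proof. by move=> [p np <-]; exists (FNot p). Qed.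

Lemma defsets_bigcup n (A : nat -> set (BorelStr L)) :
  (forall k, defsets n (A k)) -> defsets n (\bigcup_k A k).
Proof.
move=> dA; have /choice[f fP] : forall k, exists p, nform n p /\ Mod id p = A k.
  by move=> k; have [p np pE] := dA k; exists p.
exists (FDisj None f).
  by apply: nform_FDisj => k; have [] := fP k.
apply/seteqP; split=> M [k].
  by move=> Mk; exists k => //; rewrite -(fP k).2.
by move=> _; rewrite -(fP k).2 => Mk; exists k.
Qed.
End Formulas.

(** * Back and forth *)

Section BackAndForth.
Variable I : nat -> (nat -> nat) -> (nat -> nat) -> Prop.
Hypothesis I_bij : forall n s t, I n s t -> bijective s /\ bijective t.
Hypothesis forth : forall n s t y, I n s t -> (forall i, i < n -> s i <> y) ->
  exists s' t', [/\ I n.+1 s' t',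
    forall i, i < n -> s' i = s i /\ t' i = t i & s' n = y].
Hypothesis back : forall n s t y, I n s t -> (forall i, i < n -> t i <> y) ->
  exists s' t', [/\ I n.+1 s' t',
    forall i, i < n -> s' i = s i /\ t' i = t i & t' n = y].

(** The value to be adjoined next so that [m] is reached: [m] itself or, when
    [m] has already been reached, any value not yet used. *)
Lemma not_covered n (s : nat -> nat) m : bijective s ->
  exists2 y, (forall i, i < n -> s i <> y) &
    (forall s' : nat -> nat, (forall i, i < n -> s' i = s i) -> s' n = y ->
      exists2 j, j <= n & s' j = m).
Proof.
move=> /bij_inj injs.
have [[j j_n sj]|nm] := pselect (exists2 j, j < n & s j = m).
  exists (s n); first by move=> i i_n /injs ein; rewrite ein ltnn in i_n.
  by move=> s' ss' _; exists j; rewrite ?(ltnW j_n) ?ss'.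
exists m; last by move=> s' _ s'n; exists n.
by move=> i i_n sim; apply: nm; exists i.
Qed.

(** At step [n] the number [n./2] is put into the range of the left or of the right
    bijection, according to the parity of [n].  The two sequences of bijections
    stabilize at every argument; their limits [S] and [T] are bijective. *)
Lemma back_and_forth s0 t0 : I 0 s0 t0 ->
  exists S T, [/\ bijective S, bijective T &
    forall n, exists s t, I n s t /\ forall i, i < n -> S i = s i /\ T i = t i].
Proof.
move=> I0.
have /choice[F FP] : forall nst : nat * ((nat -> nat) * (nat -> nat)),
    exists st' : (nat -> nat) * (nat -> nat),
    I nst.1 nst.2.1 nst.2.2 ->
    [/\ I nst.1.+1 st'.1 st'.2,
        forall i, i < nst.1 -> st'.1 i = nst.2.1 i /\ st'.2 i = nst.2.2 i &
        exists2 j, j <= nst.1 & (if odd nst.1 then st'.2 else st'.1) j = nst.1./2].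
  move=> [n [s t]] /=; have [Inst|nI] := pselect (I n s t); last by exists (s, t).
  have [bs bt] := I_bij Inst.
  case: (odd n).
    have [y ny yP] := not_covered n n./2 bt.
    have [s' [t' [I' ag t'n]]] := back Inst ny.
    by exists (s', t') => _; split => //; apply: yP => // i /ag[].
  have [y ny yP] := not_covered n n./2 bs.
  have [s' [t' [I' ag s'n]]] := forth Inst ny.
  by exists (s', t') => _; split => //; apply: yP => // i /ag[].
pose st := fix st n := if n is n'.+1 then F (n', st n') else (s0, t0).
have Ist n : I n (st n).1 (st n).2 by elim: n => // n /(FP (n, st n))[].
have ag n i : i < n -> (st i.+1).1 i = (st n).1 i /\ (st i.+1).2 i = (st n).2 i.
  elim: n => // n IH; rewrite ltnS leq_eqVlt => /orP[/eqP->//|i_n].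
  have [_ /(_ _ i_n)[/= ag1 ag2] _] := FP (n, st n) (Ist n).
  by have [-> ->] := IH i_n; rewrite ag1 ag2.
exists (fun i => (st i.+1).1 i), (fun i => (st i.+1).2 i).
split; last by move=> n; exists (st n).1, (st n).2; split=> // i /ag.
- apply: bijective_of_inj_surj => [i j|m].
    have [bs _] := I_bij (Ist (maxn i j).+1).
    have /ag[-> _] : i < (maxn i j).+1 by rewrite ltnS leq_maxl.
    have /ag[-> _] : j < (maxn i j).+1 by rewrite ltnS leq_maxr.
    exact: bij_inj.
  have [_ _ [j jm]] := FP (m.*2, st m.*2) (Ist _); rewrite /= odd_double doubleK => <-.
  by exists j; have [] := ag m.*2.+1 j jm.
- apply: bijective_of_inj_surj => [i j|m].
    have [_ bt] := I_bij (Ist (maxn i j).+1).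
    have /ag[_ ->] : i < (maxn i j).+1 by rewrite ltnS leq_maxl.
    have /ag[_ ->] : j < (maxn i j).+1 by rewrite ltnS leq_maxr.
    exact: bij_inj.
  have [_ _ [j jm]] := FP (m.*2.+1, st m.*2.+1) (Ist _).
  rewrite /= odd_double /= uphalf_double => <-.
  by exists j; have [] := ag m.*2.+2 j jm.
Qed.
End BackAndForth.

Lemma orbit_of_pull (L : language) (M N : Str L) (S T : nat -> nat) :
  bijective S -> bijective T -> pull M S = pull N T -> Defs.orbit M N.
Proof.
move=> [S' SK S'K] [T' TK T'K] MN; exists (T \o S').
  by apply: bij_comp; [exists T'|exists S].
apply: functional_extensionality_dep => r; apply/funext => a; apply/propext.
have E c : M r (map_tuple S c) = N r (map_tuple T c).
  exact: (congr1 (fun X : Str L => X r c) MN).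
split=> [Na|[b -> Mb]].
  exists (map_tuple (S \o T') a).
    by rewrite map_tuple_comp map_tuple_id // => x /=; rewrite SK T'K.
  by rewrite -map_tuple_comp E map_tuple_comp map_tuple_id.
by rewrite -map_tuple_comp -E map_tuple_comp map_tuple_id.
Qed.

(** * If unsplittable formulas cover, one orbit has full measure *)

Section Scott.
Context (R : realType) (L : language) (L_countable : countable [set: L]).
Context (mu : probability (BorelStr L) R).
Hypothesis mu_erg : ergodic_structure mu.

Variable xi : nat -> nat -> preformula L.
Hypothesis xi_nform : forall n i, nform n (xi n i).
Hypothesis xi_unsplit : forall n i q, nform n q ->
  mu (Mod id (xi n i) `&` Mod id q) = 0%E \/ mu (Mod id (xi n i) `\` Mod id q) = 0%E.
Hypothesis xi_cover : forall n, mu (~` \bigcup_i Mod id (xi n i)) = 0%E.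

(** Injectivity of all [n.+1] values keeps the new point outside the tuple. *)
Definition extension n p : preformula L := FEx n (FAnd (distinct L n.+1) p).

Lemma nform_extension n p : nform n.+1 p -> nform n (extension n p).
Proof. by move=> np; apply/nform_FEx/nform_FAnd => //; exact: nform_distinct. Qed.

(** The formulas that unsplittable ones must decide for the back-and-forth
    argument: the atomic ones for the limit to be an isomorphism, the extension
    statements for the steps, and [xi 0 j] for the start. *)
Definition relevant : set (preformula L) :=
  (\bigcup_r range (@FRel L r)) `|`
  (range (fun nj : nat * nat => extension nj.1 (xi nj.1.+1 nj.2)) `|`
   range (xi 0)).

Lemma relevant_countable : countable relevant.
Proof.
have cr (T : countType) (f : T -> preformula L) : countable (range f).
  exact: card_le_trans (card_image_le _ _) (countableP _).
rewrite /relevant; apply: countableU; last by apply: countableU; exact: cr.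
by apply: bigcup_countable => // r _; exact: cr.
Qed.

(** The countably many null formulas by which a tuple could violate the covering
    or the unsplittability of the [xi n i] are forbidden to all injective tuples.
    The set [G] of structures satisfying these prohibitions has measure one, is closed
    under isomorphism, and is a single orbit by back and forth. *)
Lemma orbit_full : exists M, mu (Defs.orbit M) = 1%E.
Proof.
have [psi _ psi_surj] := enumerate relevant_countable (or_intror (or_intror (ex_intro2 _ _ 0 I erefl))).
(* [None] stands for a failure of the covering, [Some (i, b, k)] for a possible
   failure of [xi n i] to decide [psi k]; only the null formulas are forbidden. *)
pose bad n o := if o is Some (i, b, k)
  then FAnd (xi n i) (if b then psi k else FNot (psi k))
  else FNot (FDisj None (xi n)).
pose isbad n o := nform n (bad n o) /\ mu (Mod id (bad n o)) = 0%E.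
pose F k : set (BorelStr L) := if unpickle k is Some (n, o) then
  if `[< isbad n o >] then Mod id (exists_distinct n (bad n o)) else set0 else set0.
pose G := ~` \bigcup_k F k.
have FP k : measurable (F k) /\ mu (F k) = 0%E.
  rewrite /F; case: (unpickle k) => [[n o]|]; last by rewrite measure0.
  case: asboolP => [[nb b0]|_]; last by rewrite measure0.
  split; last by apply: null_exists_distinct => //; exact: mu_erg.1.
  by apply: Mod_measurable; exact: (sentence_exists_distinct nb).1.
have mF : measurable (\bigcup_k F k) by apply: bigcupT_measurable => k; have [] := FP k.
have muF : mu (\bigcup_k F k) = 0%E by apply: null_bigcup => k; have [] := FP k.
have mG : measurable G by exact: measurableC.
have muG : mu G = 1%E by apply: full_setC; rewrite ?setCK.
have GP M : G M <-> forall n o s, isbad n o -> bijective s -> ~ Mod s (bad n o) M.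
  split=> [GM n o s bno bs Ms|H [k _]].
    apply: GM; exists (pickle (n, o)) => //; rewrite /F pickleK asboolT //.
    by apply/Mod_exists_distinct; [exact: bno.1|exists s].
  rewrite /F; case: (unpickle k) => [[n o]|//].
  case: asboolP => // bno /(Mod_exists_distinct _ _ bno.1)[s bs].
  exact: H.
have cover M n s : G M -> bijective s -> exists i, Mod s (xi n i) M.
  move=> /GP GM bs; apply: contrapT => H; apply: (GM n None s) => //.
  split; first exact/nform_FNot/nform_FDisj.
  rewrite -(xi_cover n); congr (mu _); apply/seteqP; split=> x.
    by move=> nx [i _ xi_x]; apply: nx; exists i.
  by move=> nx [i xi_x]; apply: nx; exists i.
have decides M N s t n i q : G M -> G N -> bijective s -> bijective t ->
    relevant q -> nform n q -> Mod s (xi n i) M -> Mod t (xi n i) N ->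
    Mod s q M -> Mod t q N.
  move=> /GP GM /GP GN bs bt /psi_surj[k <-] nq Ms Nt Msq.
  have [q0|q0] := xi_unsplit i nq.
    case: (GM n (Some (i, true, k)) s) => //; last by apply/sat_FAnd.
    split; first exact: nform_FAnd.
    by rewrite -q0; congr (mu _); apply/funext => x; apply/propext/sat_FAnd.
  apply: contrapT => Ntq.
  case: (GN n (Some (i, false, k)) t) => //; last by apply/sat_FAnd.
  split; first exact: nform_FAnd.
  by rewrite -q0; congr (mu _); apply/funext => x; apply/propext/sat_FAnd.
have rel0 j : relevant (xi 0 j) by right; right; exists j.
have relE n j : relevant (extension n (xi n.+1 j)) by right; left; exists (n, j).
have relR r v : relevant (FRel r v) by left; exists r => //; exists v.
have forth M N n i s t y : G M -> G N -> bijective s -> bijective t ->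
    Mod s (xi n i) M -> Mod t (xi n i) N -> (forall i, i < n -> s i <> y) ->
    exists s' t' j, [/\ bijective s', bijective t',
      (Mod s' (xi n.+1 j) M /\ Mod t' (xi n.+1 j) N),
      forall i, i < n -> s' i = s i /\ t' i = t i & s' n = y].
  move=> GM GN bs bt Ms Nt ny.
  have [s' [bs' ss' s'n]] := bij_step bs ny.
  have [j Ms'] := cover M n.+1 s' GM bs'.
  have : Mod s (extension n (xi n.+1 j)) M.
    exists y; apply/sat_FAnd.
    have ag x : x < n.+1 -> s' x = update s n y x.
      rewrite /update ltnS leq_eqVlt => /orP[/eqP->|x_n]; first by rewrite eqxx.
      by rewrite ltn_eqF // ss'.
    split; last by apply: (sat_agreeW _ Ms') => x /(xi_nform n.+1 j).2 /ag.
    apply/sat_distinct => a b /andP[ba a_n].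
    have b_n := ltn_trans ba a_n.
    by rewrite -(ag a a_n) -(ag b b_n); apply: (@bij_inj_below n.+1 _ bs'); rewrite ba.
  move=> /(decides M N s t n i _ GM GN bs bt (relE n j) _ Ms Nt)[].
    exact: nform_extension.
  move=> z /sat_FAnd[/sat_distinct dz Nz].
  have [x xn|t' [bt' tt' t'n]] := @bij_step n t z bt.
    have := dz n x; rewrite /update eqxx ltn_eqF // ltnSn xn => H; exact: H.
  exists s', t', j; split => //; last by move=> x xn; rewrite ss' ?tt'.
  split=> //; apply: (sat_agreeW _ Nz) => x /(xi_nform n.+1 j).2 /=.
  rewrite /update ltnS leq_eqVlt => /orP[/eqP->|x_n]; first by rewrite eqxx t'n.
  by rewrite ltn_eqF // tt'.
(* A sentence [xi 0 j] true in a structure of [G] is not null, hence has measure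
   one and is true throughout [G]. *)
have start M N : G M -> G N -> exists i, Mod id (xi 0 i) M /\ Mod id (xi 0 i) N.
  move=> GM GN; have bid : bijective (id : nat -> nat) by exists id.
  have [i Mi] := cover M 0 id GM bid; have [j Nj] := cover N 0 id GN bid.
  exists j; split=> //; have [k kE] := psi_surj _ (rel0 j).
  have sj : sentence (xi 0 j).
    by have [fj nj] := xi_nform 0 j; split=> //; apply/seteqP; split=> // x /nj.
  have [j0|j1] := zero_one id mu_erg.2 sj.
    case: ((GP N).1 GN 0 (Some (j, true, k)) id) => //; last first.
      by apply/sat_FAnd; rewrite kE.
    rewrite /isbad /= kE; split; first exact: nform_FAnd.
    rewrite -j0; congr (mu _); apply/seteqP; split=> x; first by case/sat_FAnd.
    by move=> xj; apply/sat_FAnd.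
  apply: contrapT => Mj; case: ((GP M).1 GM 0 (Some (i, false, k)) id) => //; last first.
    by apply/sat_FAnd; rewrite /= kE.
  have nij := nform_FAnd (xi_nform 0 i) (nform_FNot (xi_nform 0 j)).
  rewrite /isbad /= kE; split=> //.
  apply: (null_subset (B := ~` Mod id (xi 0 j))).
  - by apply: Mod_measurable; exact: nij.1.
  - by apply: measurableC; apply: Mod_measurable; exact: sj.1.
  - by move=> x /sat_FAnd[].
  - rewrite probability_setC ?j1 ?subee //.
    by apply: Mod_measurable; exact: sj.1.
have iso M N : G M -> G N -> Defs.orbit M N.
  move=> GM GN.
  pose I n s t := [/\ bijective s, bijective t &
    exists i, Mod s (xi n i) M /\ Mod t (xi n i) N].
  have [i [Mi Ni]] := start M N GM GN.
  have [||||S [T [bS bT ST]]] := @back_and_forth I _ _ _ id id.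
  - by move=> n s t [].
  - move=> n s t y [bs bt [k [Mk Nk]]] ny.
    have [s' [t' [j [? ? ? ? ?]]]] := forth M N n k s t y GM GN bs bt Mk Nk ny.
    by exists s', t'; split=> //; split=> //; exists j.
  - move=> n s t y [bs bt [k [Mk Nk]]] ny.
    have [t' [s' [j [? ? [? ?] ag ?]]]] := forth N M n k t s y GN GM bt bs Nk Mk ny.
    exists s', t'; split=> //; first by split=> //; exists j.
    by move=> x /ag[].
  - by split; [exists id|exists id|exists i].
  apply: (orbit_of_pull bS bT).
  apply: functional_extensionality_dep => r; apply/funext => b; apply/propext.
  (* A bound on the entries of [b], so that the atomic formula is in reach of the
     finite stage [n]. *)
  pose n := (\max_(x <- b) x).+1.
  have nb : nform n (FRel r b).
    by split=> // x /= xb; rewrite /n ltnS (@leq_bigmax_seq _ _ _ id).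
  have [s [t [[bs bt [k [Mk Nk]]] ST']]] := ST n.
  have sE : map_tuple S b = map_tuple s b.
    by apply/val_inj/eq_in_map => x xb; have [] := ST' x (nb.2 x xb).
  have tE : map_tuple T b = map_tuple t b.
    by apply/val_inj/eq_in_map => x xb; have [] := ST' x (nb.2 x xb).
  rewrite /pull sE tE; split.
    exact: (decides M N s t n k _ GM GN bs bt (relR r b) nb Mk Nk).
  exact: (decides N M t s n k _ GN GM bt bs (relR r b) nb Nk Mk).
have [M GM] : exists M, G M.
  apply: contrapT => nG; move: muG; rewrite (_ : G = set0) ?measure0.
    by move=> /eqP; rewrite eq_sym onee_eq0.
  by apply/seteqP; split=> // x Gx; case: nG; exists x.
exists M; rewrite (_ : Defs.orbit M = G) //; apply/seteqP; split=> N; last exact: iso.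
move=> [s bs ->]; apply/GP => n o t bno bt.
have [s' sK s'K] := bs.
move=> H; apply: ((GP M).1 GM n o (s' \o t)) => //.
  by apply: bij_comp => //; exists s.
have := sat_pull (logic_action s M) (s' \o t) (bad n o) bs.
rewrite pull_logic_action // => E; apply/E.
by apply: (sat_agreeW _ H) => x _ /=; rewrite s'K.
Qed.

End Scott.

(** * The complete theory has no model *)

(** If no [n] had such formulas, the second alternative of [small_or_unsplit] would
    hold for every [defsets n], and [orbit_full] would yield an orbit of measure one. *)
Lemma small_covers (R : realType) (L : language) (mu : probability (BorelStr L) R) :
  countable [set: L] -> properly_ergodic mu ->
  exists n (phi : nat -> nat -> preformula L),
    [/\ forall k i, nform n (phi k i),
        forall k i, (fine (mu (Mod id (phi k i))) < k.+1%:R^-1)%R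
      & mu (\bigcap_k \bigcup_i Mod id (phi k i)) <> 0%E].
Proof.
move=> cL [erg null_orbits]; apply: contrapT => nosmall.
have /choice[xi xiP] : forall n, exists xi : nat -> preformula L,
    [/\ forall i, nform n (xi i),
        forall i q, nform n q -> mu (Mod id (xi i) `&` Mod id q) = 0%E \/
                                 mu (Mod id (xi i) `\` Mod id q) = 0%E
      & mu (~` \bigcup_i Mod id (xi i)) = 0%E].
  move=> n.
  have [[A [AP A0]]|[X [XP X0]]] := small_or_unsplit mu (@defsets_measurable L n)
      (defsets0 L n) (@defsetsC L n) (@defsets_bigcup L n).
    have /choice[phi phiP] : forall ki : nat * nat, exists p, nform n p /\ Mod id p = A ki.1 ki.2.
      by move=> [k i]; have [[p np pE] _] := AP k i; exists p.
    case: nosmall; exists n, (fun k i => phi (k, i)).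
    have phiE k i : Mod id (phi (k, i)) = A k i by have [] := phiP (k, i).
    split=> [k i|k i|]; first by have [] := phiP (k, i).
      by rewrite phiE; have [] := AP k i.
    move=> H; apply: A0; rewrite -H; congr (mu _).
    by apply: eq_bigcapr => k _; apply: eq_bigcupr => i _; rewrite phiE.
  have /choice[xi xiP] : forall i, exists p, nform n p /\ Mod id p = X i.
    by move=> i; have [[p np pE] _] := XP i; exists p.
  exists xi; split=> [i|i q nq|]; first by have [] := xiP i.
    have [_ ->] := xiP i; have [_] := XP i; apply.
    by exists q.
  rewrite -X0; congr (mu (~` _)).
  by apply: eq_bigcupr => i _; have [] := xiP i.
have [|||M M1] := @orbit_full R L cL mu erg xi.
- by move=> n; have [] := xiP n.
- by move=> n; have [] := xiP n.
- by move=> n; have [] := xiP n.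
by move: M1; rewrite null_orbits => /eqP; rewrite eq_sym onee_eq0.
Qed.

(** The theory says that some injective tuple satisfies [beta], but for each of
    the uncountably many ways [j] of satisfying [beta] it says that none satisfies it
    in that way. *)
Lemma Th_no_model (R : realType) (L : language) (mu : probability (BorelStr L) R) :
  countable [set: L] -> properly_ergodic mu ->
  ~ exists M : structure L, models_theory M (Th mu).
Proof.
move=> cL pe [N NTh]; have [[inv erg] _] := pe.
have [n [phi [nphi small pos]]] := small_covers cL pe.
(* Every choice of indices makes [beta] a conjunction of formulas of arbitrarily
   small measure. *)
pose beta := FConj None (fun k => FDisj None (phi k)).
have nbeta : nform n beta by apply: nform_FConj => k; exact: nform_FDisj.
have [a] := carrier_inhabited N; pose e0 : nat -> N := fun=> a.
have Th_beta : Th mu (exists_distinct n beta).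
  have sbeta := sentence_exists_distinct nbeta.
  split; first exact: sbeta.
  rewrite /measure_models (models_Mod id sbeta.2).
  have [b0|//] := zero_one id erg sbeta.
  case: pos; apply: null_subset b0.
  - apply: bigcapT_measurable => k; apply: bigcupT_measurable => i.
    by apply: Mod_measurable; exact: (nphi k i).1.
  - by apply: Mod_measurable; exact: sbeta.1.
  - move=> M HM; apply/Mod_exists_distinct => //; exists id; first by exists id.
    by move=> k; have [i _ Mi] := HM k I; exists i.
have /(sat_exists_distinct _ nbeta)[e inj_e ebeta] := NTh _ Th_beta e0.
have /choice[j jP] : forall k, exists i, sat e (phi k i) by move=> k; exact: (ebeta k).
pose pi := FConj None (fun k => phi k (j k)).
have npi : nform n pi by exact: nform_FConj.
have mpi : measurable (Mod id pi) by apply: Mod_measurable; exact: npi.1.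
have pi0 : mu (Mod id pi) = 0%E.
  apply: contrapT => /(fine_gt0_measure mpi) /ltr_add_invr[k].
  rewrite add0r ltNge => /negP; apply; apply: ltW; apply: le_lt_trans (small k (j k)).
  apply: fine_le_measure => //; first by apply: Mod_measurable; exact: (nphi _ _).1.
  by move=> M Mpi; exact: (Mpi k).
have spi := sentence_exists_distinct npi.
suff : Th mu (FNot (exists_distinct n pi)).
  move=> /NTh /(_ e0); apply; apply/sat_exists_distinct => //.
  by exists e.
split; first by [].
rewrite /measure_models (@models_Mod L id (FNot _) spi.2).
apply: full_setC; first by apply: measurableC; apply: Mod_measurable; exact: spi.1.
rewrite [X in ~` X](_ : _ = ~` Mod id (exists_distinct n pi)) // setCK.
exact: null_exists_distinct.
Qed.

(** * Subformulas *)

Section Subformulas.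
Context (L : language).
Implicit Types p q r : preformula L.

Lemma subformulas_refl p : subformulas p p.
Proof. by case: p => *; left. Qed.

Lemma subformulas_trans p q r :
  subformulas p q -> subformulas q r -> subformulas p r.
Proof.
elim: p => /= [x y|s v|p IH|k f IH|k f IH|x p IH|x p IH];
  move=> [-> //|] //; try by move=> ? ?; right; exact: IH.
- by move=> [i _ fq] qr; right; exists i => //; exact: IH.
- by move=> [i _ fq] qr; right; exists i => //; exact: IH.
Qed.

Lemma subformulas_countable p : countable (subformulas p).
Proof.
elim: p => /= *; apply: countableU => //; exact: bigcup_countable (countable_family _) _.
Qed.

Lemma is_formula_sub p q : is_formula p -> subformulas p q -> is_formula q.
Proof.
elim: p => /= [x y|s v|p IH|k f IH|k f IH|x p IH|x p IH] fp [-> //|] //.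
- exact: IH.
- by move=> [i _]; apply: IH; exact: fp.2.
- by move=> [i _]; apply: IH; exact: fp.2.
- exact: IH.
- exact: IH.
Qed.

Lemma sub_FNot p : subformulas (FNot p) p.
Proof. by right; exact: subformulas_refl. Qed.
Lemma sub_FConj k f i : subformulas (FConj k f) (f i : preformula L).
Proof. by right; exists i => //; exact: subformulas_refl. Qed.
Lemma sub_FDisj k f i : subformulas (FDisj k f) (f i : preformula L).
Proof. by right; exists i => //; exact: subformulas_refl. Qed.
Lemma sub_FEx x p : subformulas (FEx x p) p.
Proof. by right; exact: subformulas_refl. Qed.
Lemma sub_FAll x p : subformulas (FAll x p) p.
Proof. by right; exact: subformulas_refl. Qed.
End Subformulas.

(** * Generic structures *)

Section Generic.
Context (L : language).
Implicit Types (p : preformula L) (l : seq nat) (U V : set (BorelStr L)).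

Definition Modl l p := Mod (nth 0 l) p.

Lemma update_nth l x a : update (nth 0 l) x a = nth 0 (set_nth 0 l x a).
Proof. by apply/funext => y; rewrite nth_set_nth. Qed.

(** Deciding a formula positively, when it is a disjunction or existential,
    includes the choice of a witness; dually for conjunctions and universal
    formulas decided negatively. *)
Definition decided U l p : Prop :=
  match p with
  | FConj k f => U `<=` Modl l p \/ exists i, U `<=` ~` Modl l (f i)
  | FDisj k f => (exists i, U `<=` Modl l (f i)) \/ U `<=` ~` Modl l p
  | FEx x q => (exists a, U `<=` Modl (set_nth 0 l x a) q) \/ U `<=` ~` Modl l p
  | FAll x q => U `<=` Modl l p \/ exists a, U `<=` ~` Modl (set_nth 0 l x a) q
  | _ => U `<=` Modl l p \/ U `<=` ~` Modl l p
  end.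

Lemma decided_weak U l p : decided U l p -> U `<=` Modl l p \/ U `<=` ~` Modl l p.
Proof.
case: p => //= [k f|k f|x q|x q] [].
- by left.
- by move=> [i Ui]; right=> M /Ui nf Mp; apply: nf; exact: (Mp i).
- by move=> [i Ui]; left=> M /Ui; exists i.
- by right.
- by move=> [a Ua]; left=> M /Ua; rewrite /Modl -update_nth; exists a.
- by right.
- by left.
- by move=> [a Ua]; right=> M /Ua nf Mp; apply: nf; rewrite /Modl -update_nth; exact: (Mp a).
Qed.

Lemma decided_sub U V l p : V `<=` U -> decided U l p -> decided V l p.
Proof.
move=> VU; have W (A : set (BorelStr L)) : U `<=` A -> V `<=` A by exact: subset_trans.
case: p => /= [x y|r v|q|k f|k f|x q|x q].
- by case=> /W; [left|right].
- by case=> /W; [left|right].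
- by case=> /W; [left|right].
- by case=> [/W|[i /W Vi]]; [left|right; exists i].
- by case=> [[i /W Vi]|/W]; [left; exists i|right].
- by case=> [[i /W Vi]|/W]; [left; exists i|right].
- by case=> [/W|[i /W Vi]]; [left|right; exists i].
Qed.

Variable U : nat -> set (BorelStr L).
Hypothesis U_decr : forall k m, k <= m -> U m `<=` U k.
Hypothesis U_ex : forall k, U k !=set0.
Variable H : set (preformula L).
Hypothesis H_sub : forall p q, H p -> subformulas p q -> H q.
Hypothesis U_dec : forall p l, H p -> exists k, decided (U k) l p.

Definition generic : Str L := fun r a => exists k, U k `<=` [set M : Str L | M r a].

(** As the stages are nested and nonempty, no formula is decided both ways.
    Witnesses carry the induction through the quantifiers and the infinitary
    connectives. *)
Lemma generic_truth p l : H p ->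
  (forall k, U k `<=` Modl l p -> Modl l p generic) /\
  (forall k, U k `<=` ~` Modl l p -> ~ Modl l p generic).
Proof.
have contra k m V : U k `<=` V -> U m `<=` ~` V -> False.
  move=> UV UnV; have [M UM] := U_ex (maxn k m).
  by apply: (UnV M); [apply: U_decr UM; exact: leq_maxr|apply: UV; apply: U_decr UM; exact: leq_maxl].
elim: p l => [x y|r v|p IH|j f IH|j f IH|x p IH|x p IH] l Hp.
- split=> k Uk; have [M UM] := U_ex k; exact: (Uk M UM).
- split=> k Uk; first by exists k.
  by move=> [m Um]; exact: contra Um Uk.
- have [IH1 IH2] := IH l (H_sub Hp (sub_FNot p)); split=> k Uk.
    exact: IH2 Uk.
  move=> np; apply: np; apply: (IH1 k) => M UM.
  by apply: contrapT; exact: (Uk M UM).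
- have Hf i := H_sub Hp (sub_FConj f i); split=> k Uk.
    move=> i; have [m /decided_weak[]] := U_dec l (Hf i); first exact: (IH i l (Hf i)).1.
    move=> Um; case: (@contra k m (Modl l (f i))) => // M UM; exact: (Uk M UM i).
  have [m /= [Um|[i Ui]]] := U_dec l Hp; first by case: (contra _ _ _ Um Uk).
  by move=> Mf; apply: (IH i l (Hf i)).2 Ui _; exact: (Mf i).
- have Hf i := H_sub Hp (sub_FDisj f i); split=> k Uk.
    have [m /= [[i Ui]|Um]] := U_dec l Hp; last by case: (contra _ _ _ Uk Um).
    by exists i; exact: (IH i l (Hf i)).1 Ui.
  move=> [i Mi]; have [m /decided_weak[Um|Um]] := U_dec l (Hf i).
    by case: (@contra m k (Modl l (FDisj j f))) => // M UM; exists i; exact: Um.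
  exact: (IH i l (Hf i)).2 Um Mi.
- have Hq := H_sub Hp (sub_FEx x p); split=> k Uk.
    have [m /= [[a Ua]|Um]] := U_dec l Hp; last by case: (contra _ _ _ Uk Um).
    by exists a; rewrite update_nth; exact: (IH _ Hq).1 Ua.
  move=> [a Ma]; rewrite update_nth in Ma.
  have [m /decided_weak[Um|Um]] := U_dec (set_nth 0 l x a) Hq.
    case: (@contra m k (Modl l (FEx x p))) => // M UM; exists a.
    by rewrite update_nth; exact: Um.
  exact: (IH _ Hq).2 Um Ma.
- have Hq := H_sub Hp (sub_FAll x p); split=> k Uk.
    move=> a; rewrite update_nth.
    have [m /decided_weak[]] := U_dec (set_nth 0 l x a) Hq; first exact: (IH _ Hq).1.
    move=> Um; case: (@contra k m (Modl (set_nth 0 l x a) p)) => // M UM.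
    by rewrite /Modl -update_nth; exact: (Uk M UM a).
  have [m /= [Um|[a Ua]]] := U_dec l Hp; first by case: (contra _ _ _ Um Uk).
  by move=> Mf; apply: (IH _ Hq).2 Ua _; rewrite /Modl -update_nth; exact: (Mf a).
Qed.
End Generic.

(** * A tree of positive sets *)

Section Tree.
Context (R : realType) (L : language) (mu : probability (BorelStr L) R).
Implicit Types (U V : set (BorelStr L)).

Definition positive U := measurable U /\ mu U <> 0%E.

Lemma positive_split U A : positive U -> measurable A ->
  positive (U `&` A) \/ positive (U `&` ~` A).
Proof.
move=> [mU U0] mA; have [UA0|UA0] := pselect (mu (U `&` A) = 0%E); last first.
  by left; split=> //; exact: measurableI.
right; split; first exact: measurableD.
move=> UD0; apply: U0; rewrite (measureDI _ mU mA).
by rewrite [X in (_ + X)%E]UA0 [X in (X + _)%E]UD0 adde0.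
Qed.

Lemma positive_cover (J : Type) U (A : J -> set (BorelStr L)) :
  countable [set: J] -> positive U -> (forall i, measurable (A i)) ->
  U `<=` \bigcup_i A i -> exists i, positive (U `&` A i).
Proof.
move=> cI [mU U0] mA UA; apply: contrapT => nA; apply: U0.
have [[i0]|nI] := pselect (inhabited J); last first.
  rewrite (_ : U = set0) ?measure0 //; apply/seteqP; split=> // x /UA[i _ _].
  by apply: nI.
have [f _ fsurj] := enumerate cI (I : [set: J] i0).
apply: (null_subset (B := \bigcup_k (U `&` A (f k)))) => //.
- by apply: bigcupT_measurable => k; exact: measurableI.
- by move=> x Ux; have [i _ Ai] := UA x Ux; have [k fk] := fsurj i I; exists k; rewrite ?fk.
- apply: null_bigcup => k; first exact: measurableI.
  by apply: contrapT => Ak; apply: nA; exists (f k); split=> //; exact: measurableI.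
Qed.

(** One of countably many witnesses keeps the measure positive. *)
Lemma positive_decide U l (p : preformula L) : positive U -> is_formula p ->
  exists V, [/\ positive V, V `<=` U & decided V l p].
Proof.
move=> pU fp; have mp := Mod_measurable (nth 0 l) fp.
have [pV|pV] := positive_split pU mp.
  have VU : U `&` Modl l p `<=` U by move=> x [].
  case: p fp mp pV VU => /=; try by move=> *; eexists; split; try eassumption; left => x [].
  - move=> k f [_ ff] mp pV VU.
    have [i|x [_ [i Mi]]|i [mV V0]] := positive_cover (A := fun i => Modl l (f i)) (countable_family k) pV.
    + by apply: Mod_measurable.
    + by exists i.
    + exists (U `&` Modl l (FDisj k f) `&` Modl l (f i)); split=> // [x [[]] //|].
      by left; exists i => x [].
  - move=> x p fp mp pV VU.
    have [a|M [_ [a Ma]]|a [mV V0]] := positive_cover (A := fun a => Modl (set_nth 0 l x a) p) (countableP _) pV.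
    + by apply: Mod_measurable.
    + by exists a => //; rewrite /Modl -update_nth.
    + exists (U `&` Modl l (FEx x p) `&` Modl (set_nth 0 l x a) p); split=> // [y [[]] //|].
      by left; exists a => y [].
have VU : U `&` ~` Modl l p `<=` U by move=> x [].
case: p fp mp pV VU => /=; try by move=> *; eexists; split; try eassumption; right => x [].
- move=> k f [_ ff] mp pV VU.
  have [i|x [_ /existsNP[i Mi]]|i [mV V0]] := positive_cover (A := fun i => ~` Modl l (f i)) (countable_family k) pV.
  + by apply: measurableC; apply: Mod_measurable.
  + by exists i.
  + exists (U `&` ~` Modl l (FConj k f) `&` ~` Modl l (f i)); split=> // [x [[]] //|].
    by right; exists i => x [].
- move=> x p fp mp pV VU.
  have [a|M [_ /existsNP[a Ma]]|a [mV V0]] := positive_cover (A := fun a => ~` Modl (set_nth 0 l x a) p) (countableP _) pV.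
  + by apply: measurableC; apply: Mod_measurable.
  + by exists a => //; rewrite /Modl -update_nth.
  + exists (U `&` ~` Modl l (FAll x p) `&` ~` Modl (set_nth 0 l x a) p); split=> // [y [[]] //|].
    by right; exists a => y [].
Qed.

Variables (n : nat) (phi : nat -> nat -> preformula L).
Hypothesis phi_nform : forall k i, nform n (phi k i).
Hypothesis phi_small : forall k i, (fine (mu (Mod id (phi k i))) < k.+1%:R^-1)%R.
Hypothesis phi_pos : mu (\bigcap_k \bigcup_i Mod id (phi k i)) <> 0%E.
Variable F : set (preformula L).
Hypothesis F_frag : fragment F.
Hypothesis F_countable : countable F.

Let U0 := \bigcap_k \bigcup_i Mod id (phi k i).

Lemma phi_measurable k i : measurable (Mod id (phi k i)).
Proof. by apply: Mod_measurable; exact: (phi_nform k i).1. Qed.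

(** The measure of [V] exceeds some 1/(m+1), so a set [Mod id (phi m i)] meeting [V]
    in positive measure cannot contain almost all of [V]. *)
Lemma positive_fork V : positive V -> V `<=` U0 ->
  exists m i, positive (V `&` Mod id (phi m i)) /\ positive (V `&` ~` Mod id (phi m i)).
Proof.
move=> pV VU0; have [mV V0] := pV.
have [m] := ltr_add_invr (fine_gt0_measure mV V0); rewrite add0r => ltm.
have [|| i pVi] := positive_cover (A := fun i => Mod id (phi m i)) (countableP _) pV.
- exact: phi_measurable.
- by move=> x /VU0; apply.
exists m, i; split=> //; split.
  by apply: measurableI => //; apply: measurableC; exact: phi_measurable.
move=> D0; have := lt_trans (phi_small m i) ltm; rewrite ltNge => /negP; apply.
rewrite (fine_measureD mu mV (phi_measurable m i)) [mu (V `\` _)]D0 add0r.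
by apply: fine_le_measure; [exact: pVi.1|exact: phi_measurable|move=> x []].
Qed.

(** The formulas to be decided: those of the fragment, together with those that
    separate the branches, closed under subformulas. *)
Definition hull : set (preformula L) :=
  F `|` \bigcup_ki subformulas (phi ki.1 ki.2).

Lemma hull_countable : countable hull.
Proof.
apply: countableU => //; apply: bigcup_countable => // ki _.
exact: subformulas_countable.
Qed.

Lemma hull_sub p q : hull p -> subformulas p q -> hull q.
Proof.
move=> [Fp|[ki _ pki]] pq; first by left; exact: fragment_sub Fp pq.
by right; exists ki => //; exact: subformulas_trans pki pq.
Qed.

Lemma hull_formula p : hull p -> is_formula p.
Proof.
move=> [/(fragment_formula F_frag)//|[ki _]].
by apply: is_formula_sub; exact: (phi_nform _ _).1.
Qed.

Lemma hull_phi k i : hull (phi k i).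
Proof. by right; exists (k, i) => //; exact: subformulas_refl. Qed.

(** The tree of positive sets: from [U], at level [k], the [k]-th requirement is
    decided, and then the set is forked by some [phi m i]. *)
Lemma many_models : exists N : (nat -> bool) -> Str L,
  (forall c, models_theory (nat_structure (N c)) (ThF F mu)) /\
  (forall c c', (forall m i, Mod id (phi m i) (N c) <-> Mod id (phi m i) (N c')) -> c = c').
Proof.
have [h hH hsurj] := enumerate hull_countable (hull_phi 0 0).
pose req k : seq nat * preformula L := if unpickle k is Some (a, l) then (l, h a) else ([::], h 0).
have Hreq k : hull (req k).2 by rewrite /req; case: (unpickle k) => [[a l]|]; exact: hH.
have /choice[step stepP] : forall kU : nat * set (BorelStr L),
   exists V : bool -> set (BorelStr L), positive kU.2 -> kU.2 `<=` U0 ->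
     (forall b, [/\ positive (V b), V b `<=` kU.2 & decided (V b) (req kU.1).1 (req kU.1).2]) /\
     exists m i, V true `<=` Mod id (phi m i) /\ V false `<=` ~` Mod id (phi m i).
  move=> [k U] /=.
  have [[pU UU0]|nU] := pselect (positive U /\ U `<=` U0); last first.
    by exists (fun=> set0) => pU UU0; case: nU.
  have [V [pV VU dV]] := positive_decide (req k).1 pU (hull_formula (Hreq k)).
  have [m [i [pT pF]]] := positive_fork pV (subset_trans VU UU0).
  exists (fun b => V `&` (if b then Mod id (phi m i) else ~` Mod id (phi m i))) => _ _.
  split; last by exists m, i; split=> x [].
  have VbV (A : set (BorelStr L)) : V `&` A `<=` V by move=> x [].
  by case; split=> //; first [exact: subset_trans (VbV _) VU|exact: decided_sub (VbV _) dV].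
pose br := fix br (c : nat -> bool) k :=
  if k is k'.+1 then step (k', br c k') (c k') else U0.
have brP c k : positive (br c k) /\ br c k `<=` U0.
  elim: k => [|k [IH1 IH2]].
    split=> //; split=> //; apply: bigcapT_measurable => k; apply: bigcupT_measurable => i.
    exact: phi_measurable.
  have [/(_ (c k))[pV VU _] _] := stepP (k, br c k) IH1 IH2.
  by split=> //; exact: subset_trans VU IH2.
have brS c k := stepP (k, br c k) (brP c k).1 (brP c k).2.
have br_decr c k m : k <= m -> br c m `<=` br c k.
  elim: m => [|m IH]; first by rewrite leqn0 => /eqP->.
  rewrite leq_eqVlt => /orP[/eqP->//|/IH]; apply: subset_trans.
  by have [/(_ (c m))[]] := brS c m.
have br_ex c k : br c k !=set0.
  by apply/set0P/eqP => E; case: (brP c k) => -[_]; rewrite E measure0.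
have br_dec c p l : hull p -> exists k, decided (br c k) l p.
  move=> /hsurj[a <-]; exists (pickle (a, l)).+1.
  have [/(_ (c (pickle (a, l))))[_ _] + _] := brS c (pickle (a, l)).
  by rewrite /req pickleK.
pose N c := generic (br c).
have truth c p l := generic_truth (br_decr c) (br_ex c) hull_sub (br_dec c) l (p := p).
exists N; split=> [c p [[sp p1] Fp] e|c c' cc'].
  have Hp : hull p by left.
  suff H : Modl [::] p (N c) by apply: (sat_agreeW _ H) => x; rewrite sp.2.
  have [k /decided_weak[|kp]] := br_dec c p [::] Hp; first exact: (truth c p _ Hp).1.
  have [[mb b0] _] := brP c k; case: b0; apply: null_subset kp _ => //.
    by apply: measurableC; apply: Mod_measurable; exact: sp.1.
  move: p1; rewrite /measure_models (models_Mod (nth 0 [::]) sp.2) => p1.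
  rewrite probability_setC ?p1 ?subee //.
  by apply: Mod_measurable; exact: sp.1.
apply: contrapT => ncc'.
have : exists k, c k != c' k.
  apply: contrapT => H; apply: ncc'; apply/funext => k; apply/eqP.
  by apply: contrapT => /negP ck; apply: H; exists k.
move=> /ex_minnP[k ck kmin].
(* The branches [c] and [c'] first separate at level [k]. *)
have brE : br c k = br c' k.
  have : forall j, j < k -> c j = c' j.
    by move=> j jk; apply/eqP; apply: contraTT jk => /kmin; rewrite leqNgt.
  elim: (k) => //= j IH H; rewrite IH ?H // => i ij; apply: H.
  exact: ltnW.
have [_ [m [i [Vt Vf]]]] := brS c k.
have idE M : Mod id (phi m i) M <-> Modl (iota 0 n) (phi m i) M.
  by apply: sat_agree => x /(phi_nform m i).2 xn; rewrite nth_iota.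
have Hphi := hull_phi m i.
have yes d : br d k = br c k -> d k = true -> Mod id (phi m i) (N d).
  move=> dE dk; apply/idE; apply: (truth d _ _ Hphi).1 k.+1 _.
  by rewrite /= dE dk => M /Vt /idE.
have no d : br d k = br c k -> d k = false -> ~ Mod id (phi m i) (N d).
  move=> dE dk /idE; apply: (truth d _ _ Hphi).2 k.+1 _.
  by rewrite /= dE dk => M /Vf nM /idE.
move: ck; case ck : (c k); case c'k : (c' k) => // _.
  by apply: (no c') => //; apply/cc'; exact: yes.
by apply: (no c) => //; apply/cc'; exact: yes.
Qed.
End Tree.

(** * Counting isomorphism classes *)

Definition iso_map (L : language) (M N : structure L) (f : M -> N) : Prop :=
  bijective f /\ forall (r : L) (a : (arity r).-tuple M),
      rel_interp a <-> rel_interp (map_tuple f a).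

Lemma isomorphic_refl (L : language) (M : structure L) : isomorphic M M.
Proof.
exists id; split=> [|r a]; first by exists id.
by rewrite map_tuple_id.
Qed.

Lemma isomorphic_sym (L : language) (M N : structure L) :
  isomorphic M N -> isomorphic N M.
Proof.
move=> [f [[g fK gK] fM]]; exists g; split=> [|r a]; first by exists f.
by rewrite fM map_tuple_comp map_tuple_id.
Qed.

Lemma isomorphic_trans (L : language) (M N P : structure L) :
  isomorphic M N -> isomorphic N P -> isomorphic M P.
Proof.
move=> [f [bf fM]] [g [bg gM]]; exists (g \o f); split=> [|r a].
  exact: bij_comp.
by rewrite fM gM map_tuple_comp.
Qed.

Lemma isomorphic_models (L : language) (M N : structure L) (T : set (preformula L)) :
  isomorphic M N -> models_theory M T -> models_theory N T.
Proof.
move=> [f [bf fM]] MT p Tp e; have [g fK gK] := bf.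
have -> : e = f \o (g \o e) by apply/funext => x /=; rewrite gK.
by apply/(sat_iso bf fM); exact: MT.
Qed.

Lemma isomorphic_countable (L : language) (M N : structure L) :
  isomorphic M N -> countable [set: M] -> countable [set: N].
Proof.
move=> [f [[g fK gK] _]]; apply: card_le_trans.
apply: card_le_trans (card_image_le f _).
by apply: subset_card_le => y _; exists (g y).
Qed.

(** A countable structure is determined up to isomorphism by the pullback of
    equality and of the relations along an enumeration of its carrier. *)
Lemma structure_code (L : language) : countable [set: L] ->
  exists code : structure L -> nat -> bool,
    forall N N' : structure L, countable [set: N] -> countable [set: N'] ->
      code N = code N' -> isomorphic N N'.
Proof.
move=> /countable_injP[iota /in2TT iota_inj].
have gex (N : structure L) : exists g : nat -> N,
    countable [set: N] -> forall x, exists k, g k = x.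
  have [x0] := carrier_inhabited N.
  have [cN|ncN] := pselect (countable [set: N]); last by exists (fun=> x0).
  by have [g _ gP] := enumerate cN (I : [set: N] x0); exists g => _ x; exact: gP.
pose g N := sval (cid (gex N)).
have gP (N : structure L) : countable [set: N] -> forall x, exists k, g N k = x := svalP (cid (gex N)).
pose code (N : structure L) m : bool :=
  match (unpickle m : option ((nat * nat) + (nat * seq nat))) with
  | Some (inl (x, y)) => `[< g N x = g N y >]
  | Some (inr (i, s)) => `[< exists (r : L) (a : (arity r).-tuple nat),
        [/\ iota r = i, val a = s & rel_interp (map_tuple (g N) a)] >]
  | None => false
  end.
exists code => N N' cN cN' NN'.
have eqE x y : g N x = g N y <-> g N' x = g N' y.
  have codeE (P : structure L) :
      code P (pickle (inl (x, y) : (nat * nat) + (nat * seq nat))) =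
      `[< g P x = g P y >] by rewrite /code pickleK.
  by apply: asbool_eq_equiv; rewrite -!codeE NN'.
have relE (r : L) (a : (arity r).-tuple nat) :
    rel_interp (map_tuple (g N) a) <-> rel_interp (map_tuple (g N') a).
  have codeE (P : structure L) :
      code P (pickle (inr (iota r, val a) : (nat * nat) + (nat * seq nat))) =
      `[< rel_interp (map_tuple (g P) a) >].
    rewrite /code pickleK; apply: asbool_equiv_eq; split; last by move=> H; exists r, a.
    move=> [r' [a' [/iota_inj rr aa]]]; move: a' aa; rewrite rr => a' aa.
    by rewrite -(val_inj aa).
  by apply: asbool_eq_equiv; rewrite -!codeE NN'.
have /choice[sel selK] := gP N cN.
have /choice[sel' sel'K] := gP N' cN'.
exists (fun z => g N' (sel z)); split.
  exists (fun z => g N (sel' z)) => z.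
    by rewrite -[RHS]selK; apply/eqE; rewrite sel'K.
  by rewrite -[RHS]sel'K; apply/eqE; rewrite selK.
move=> r a; have := relE r (map_tuple sel a).
by rewrite !map_tuple_comp (@map_tuple_id N).
Qed.

(** Isomorphism classes of countable models are identified with a subset [Q] of
    the Cantor space through codes of representatives.  For a tuple [l] of numbers
    and [q] in [Q], at most one [N c] is isomorphic to the structure [K q] with [l]
    coding the images of [e c 0, ..., e c (n-1)], because the types of these tuples
    determine [c].  So countably many partial functions on [Q] jointly cover the
    Cantor space. *)
Lemma continuum_many (L : language) (T : set (preformula L)) n (Phi : set (preformula L))
    (N : (nat -> bool) -> structure L) (e : forall c, nat -> N c) :
  countable [set: L] ->
  (forall p, Phi p -> free_vars p `<=` `I_n) ->
  (forall c, countable [set: N c] /\ models_theory (N c) T) ->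
  (forall c c', (forall p, Phi p -> sat (e c) p <-> sat (e c') p) -> c = c') ->
  continuum_many_countable_models T.
Proof.
move=> cL Phi_n NP sep; have [code codeP] := structure_code cL.
have /choice[pick pickP] : forall X : set (structure L), exists M : structure L,
    X !=set0 -> X M.
  move=> X; have [[M XM]|nX] := pselect (X !=set0); first by exists M.
  by exists (N (fun=> true)).
(* The representative depends only on the isomorphism class, the chosen set being
   the same for isomorphic structures. *)
pose rep M := pick [set M' | isomorphic M M'].
have repP M : isomorphic M (rep M).
  by apply: (pickP [set M' | isomorphic M M']); exists M; exact: isomorphic_refl.
have rep_eq M M' : isomorphic M M' -> rep M = rep M'.
  move=> MM'; congr pick; apply/seteqP; split=> P /=.
    by apply: isomorphic_trans; exact: isomorphic_sym.
  exact: isomorphic_trans.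
pose good (M : structure L) := countable [set: M] /\ models_theory M T.
have good_iso M M' : isomorphic M M' -> good M -> good M'.
  by move=> MM' [cM MT]; split; [exact: isomorphic_countable MM' cM|exact: isomorphic_models MM' MT].
pose Q := [set code (rep M) | M in good].
have /choice[K KP] : forall q, exists M, Q q -> [/\ good M, rep M = M & code M = q].
  move=> q; have [[M gM qE]|nQ] := pselect (Q q); last by exists (N q).
  exists (rep M) => _; split=> //; first exact: good_iso gM.
  by apply/esym/rep_eq.
have K_inj q q' : Q q -> Q q' -> isomorphic (K q) (K q') -> q = q'.
  move=> /KP[_ rq cq] /KP[_ rq' cq'] /rep_eq.
  by rewrite rq rq' => KK; rewrite -cq -cq' KK.
have K_surj M : good M -> exists2 q, Q q & isomorphic M (K q).
  move=> gM; have Qq : Q (code (rep M)) by exists M.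
  exists (code (rep M)) => //; have [gK rK cK] := KP _ Qq.
  apply: isomorphic_trans (repP M) _.
  by apply: codeP; [exact: (good_iso _ _ (repP M) gM).1|exact: gK.1|].
have iex (M : structure L) : exists iota : M -> nat,
    countable [set: M] -> injective iota.
  have [/countable_injP[f /in2TT f_inj]|nc] := pselect (countable [set: M]).
    by exists f.
  by exists (fun=> 0).
pose iota M := sval (cid (iex M)).
have iotaP (M : structure L) : countable [set: M] -> injective (iota M) := svalP (cid (iex M)).
have /choice[g gP] : forall lq : seq nat * (nat -> bool), exists c, forall c',
    Q lq.2 -> (exists2 f : N c' -> K lq.2, iso_map f & mkseq (fun i => iota (K lq.2) (f (e c' i))) n = lq.1) ->
    c = c'.
  move=> [l q] /=; have [[c [Qq [f isof fl]]]|nc] := pselect (exists c, Q q /\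
     exists2 f : N c -> K q, iso_map f & mkseq (fun i => iota (K q) (f (e c i))) n = l); last first.
    by exists q => c' Qq H; case: nc; exists c'.
  exists c => c' _ [f' isof' f'l]; apply: sep => p Pp.
  have [bf fM] := isof; have [bf' f'M] := isof'.
  rewrite -(sat_iso bf fM) -(sat_iso bf' f'M).
  apply: sat_agree => x /(Phi_n p Pp) xn /=.
  apply: (iotaP (K q)); first by have [[]] := KP q Qq.
  by have := congr1 (fun s => nth 0 s x) (etrans fl (esym f'l)); rewrite !nth_mkseq.
have [|h h_inj hQ] := @cantor_space_injects (seq nat) Q (fun l q => g (l, q)).
  move=> c; have [q Qq [f isof]] := K_surj (N c) (NP c).
  exists (mkseq (fun i => iota (K q) (f (e c i))) n), q; split=> //.
  by apply: (gP (_, q)) => //; exists f.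
have : ([set: nat -> bool] #= Q)%card.
  apply: Cantor_Bernstein; last exact: subset_card_le.
  apply: card_le_trans (subset_card_le (_ : range h `<=` Q)); last by move=> _ [c _ <-].
  by have /card_esym := @inj_card_eq _ _ [set: nat -> bool] h (in2W h_inj); rewrite card_eq_le => /andP[].
move=> /card_set_bijP[b [b1 b2 b3]].
exists (fun c => K (b c)); split=> [c|c c' /K_inj bb|M cM MT].
- by have [] := KP (b c) (b1 c I).
- by apply: b2; rewrite ?inE //; apply: bb; exact: b1.
- have [q Qq Mq] := K_surj M (conj cM MT).
  by have [c _ bc] := b3 q Qq; exists c; rewrite bc.
Qed.

Theorem corollary4p9 (R : realType) (L : language)
    (L_countable : countable [set: L])
    (mu : probability (BorelStr L) R) (mu_pe : properly_ergodic mu) :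
  (~ exists M : structure L, models_theory M (Th mu)) /\
  (forall F : set (preformula L), fragment F -> countable F ->
     continuum_many_countable_models (ThF F mu)).
Proof.
split=> [|F F_frag F_countable]; first exact: Th_no_model.
have [n [phi [nphi small pos]]] := small_covers L_countable mu_pe.
have [N [N_models N_sep]] := many_models nphi small pos F_frag F_countable.
apply: (@continuum_many L _ n [set phi mi.1 mi.2 | mi in [set: nat * nat]]
  (fun c => nat_structure (N c)) (fun=> id)) => //.
- by move=> _ [mi _ <-]; exact: (nphi _ _).2.
- by move=> c; split; [exact: (@countableP nat)|exact: N_models].
- move=> c c' cc'; apply: N_sep => m i; apply: cc'.
  by exists (m, i).
Qed.
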